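(* Assume the standing setting and the approximation setting of the context, with the stability conditions (S1), (S2) and (S-seq) and the consistency conditions (C1), (C2). Then the Strang splitting with spatial approximation is convergent at every time level $t>0$: for every $x\in X$, $$\lim_{n,m\to\infty}J_m[T_m(t/2n)S_m(t/n)T_m(t/2n)]^nP_mx=U(t)x,$$ i.e. for every $\varepsilon>0$ there is $N$ such that the norm of the difference is at most $\varepsilon$ for all $n,m\ge N$.
   Context: Standing setting: $X$ is a Banach space; $A$, $B$ are closed densely defined operators generating strongly continuous semigroups $(T(t))_{t\ge0}$, $(S(t))_{t\ge0}$ on $X$; the closure $\overline{A+B}$ satisfies $D(A)\cap D(B)\subset D(\overline{A+B})$ and generates a strongly continuous semigroup $(U(t))_{t\ge0}$. Approximation setting: $X_m$ ($m\in\mathbb{N}$) are Banach spaces, $P_m:X\to X_m$, $J_m:X_m\to X$ bounded linear operators with $P_mJ_m=I_m$, $J_mP_mx\to x$ for all $x\in X$, and $\|J_m\|\le M_J$, $\|P_m\|\le M_P$ for all $m$. Operators $A_m$, $B_m$ generate strongly continuous semigroups $(T_m(t))_{t\ge0}$, $(S_m(t))_{t\ge0}$ on $X_m$. Stability: (S1) there are $M_T\ge1$, $\omega_T$ with $\|T(h)\|,\|T_m(h)\|\le M_Te^{\omega_Th}$ for all $h>0$, $m$; (S2) there are $M_S\ge1$, $\omega_S$ with $\|S(h)\|,\|S_m(h)\|\le M_Se^{\omega_Sh}$ for all $h>0$, $m$; (S-seq) there are $M\ge1$, $\omega\in\mathbb{R}$ with $\|[S_m(t/n)T_m(t/n)]^k\|\le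 Me^{k\omega t/n}$ for all $t\ge0$, $k,n,m\in\mathbb{N}$. Consistency: (C1) $J_mA_mP_mx\to Ax$ for all $x\in D(A)$; (C2) $J_mB_mP_mx\to Bx$ for all $x\in D(B)$. *)

(* Defs.v *)
From Stdlib Require Import Reals Lra.
Open Scope R_scope.

(** Real Banach spaces (a complex Banach space is in particular one). *)
Record Banach := {
  car :> Type;
  vzero : car;
  vadd : car -> car -> car;
  vopp : car -> car;
  vscal : R -> car -> car;
  vnorm : car -> R;
  vadd_assoc : forall x y z, vadd x (vadd y z) = vadd (vadd x y) z;
  vadd_comm : forall x y, vadd x y = vadd y x;
  vadd_zero : forall x, vadd x vzero = x;
  vadd_opp : forall x, vadd x (vopp x) = vzero;
  vscal_assoc : forall a b x, vscal a (vscal b x) = vscal (a * b) x;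
  vscal_one : forall x, vscal 1 x = x;
  vscal_distr_l : forall a x y, vscal a (vadd x y) = vadd (vscal a x) (vscal a y);
  vscal_distr_r : forall a b x, vscal (a + b) x = vadd (vscal a x) (vscal b x);
  vnorm_nonneg : forall x, 0 <= vnorm x;
  vnorm_eq0 : forall x, vnorm x = 0 -> x = vzero;
  vnorm_triangle : forall x y, vnorm (vadd x y) <= vnorm x + vnorm y;
  vnorm_scal : forall a x, vnorm (vscal a x) = Rabs a * vnorm x;
  vcomplete : forall u : nat -> car,
    (forall eps, 0 < eps -> exists N, forall p q, (N <= p)%nat -> (N <= q)%nat ->
        vnorm (vadd (u p) (vopp (u q))) < eps) ->
    exists l, forall eps, 0 < eps -> exists N, forall p, (N <= p)%nat ->
        vnorm (vadd (u p) (vopp l)) < eps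
}.

Arguments vzero {_}. Arguments vadd {_}. Arguments vopp {_}.
Arguments vscal {_}. Arguments vnorm {_}.

Definition vsub {X : Banach} (x y : X) : X := vadd x (vopp y).

Definition seq_lim {X : Banach} (u : nat -> X) (l : X) : Prop :=
  forall eps, 0 < eps -> exists N, forall k, (N <= k)%nat -> vnorm (vsub (u k) l) < eps.

Definition rlim0 {X : Banach} (f : R -> X) (l : X) : Prop :=
  forall eps, 0 < eps -> exists delta, 0 < delta /\
    forall h, 0 < h < delta -> vnorm (vsub (f h) l) < eps.

Definition is_linear {X Y : Banach} (f : X -> Y) : Prop :=
  (forall x y, f (vadd x y) = vadd (f x) (f y)) /\
  (forall a x, f (vscal a x) = vscal a (f x)).

Definition is_bounded_linear {X Y : Banach} (f : X -> Y) : Prop :=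
  is_linear f /\ exists C, forall x, vnorm (f x) <= C * vnorm x.

Record Op (X : Banach) := { dom : X -> Prop; app : X -> X }.
Arguments dom {_}. Arguments app {_}.

Definition is_linear_op {X : Banach} (A : Op X) : Prop :=
  dom A vzero /\
  (forall x y, dom A x -> dom A y -> dom A (vadd x y) /\
       app A (vadd x y) = vadd (app A x) (app A y)) /\
  (forall a x, dom A x -> dom A (vscal a x) /\ app A (vscal a x) = vscal a (app A x)).

Definition densely_defined {X : Banach} (A : Op X) : Prop :=
  forall x eps, 0 < eps -> exists y, dom A y /\ vnorm (vsub x y) < eps.

Definition closed_op {X : Banach} (A : Op X) : Prop :=
  forall (u : nat -> X) x y, (forall k, dom A (u k)) ->
    seq_lim u x -> seq_lim (fun k => app A (u k)) y -> dom A x /\ app A x = y.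

Definition op_sum {X : Banach} (A B : Op X) : Op X :=
  {| dom := fun x => dom A x /\ dom B x; app := fun x => vadd (app A x) (app B x) |}.

Definition is_closure_of {X : Banach} (C C0 : Op X) : Prop :=
  forall x y, (dom C x /\ app C x = y) <->
    exists u : nat -> X, (forall k, dom C0 (u k)) /\ seq_lim u x /\
       seq_lim (fun k => app C0 (u k)) y.

(** Strongly continuous semigroups (T t is only meaningful for t >= 0). *)
Definition is_C0_semigroup {X : Banach} (T : R -> X -> X) : Prop :=
  (forall t, 0 <= t -> is_bounded_linear (T t)) /\
  (forall x, T 0 x = x) /\
  (forall s t x, 0 <= s -> 0 <= t -> T (s + t) x = T s (T t x)) /\
  (forall x, rlim0 (fun h => T h x) x).

Definition generates {X : Banach} (A : Op X) (T : R -> X -> X) : Prop :=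
  is_C0_semigroup T /\
  forall x, (dom A x <-> exists y, rlim0 (fun h => vscal (/ h) (vsub (T h x) x)) y) /\
            (dom A x -> rlim0 (fun h => vscal (/ h) (vsub (T h x) x)) (app A x)).

(* Main.v *)
(** With [h = t/n] and [F_m(h) = T_m(h/2) S_m(h) T_m(h/2)], the identity
    [F_m(h)^(k+1) = T_m(h/2) (S_m(h) T_m(h))^k S_m(h) T_m(h/2)] transfers the stability of the
    sequential splitting to [F_m], and a mean value inequality for the approximating semigroups
    gives [F_m(h) P_m x - P_m x = h P_m (A x + B x) + o(h)] on [D(A)] inter [D(B)], jointly as
    [h -> 0] and [m -> oo].

    Convergence follows as in Chernoff's theorem, but with resolvents on the discrete side only.
    Let [G] be (a truncated Neumann series for) the resolvent at [lam] of [(F_m(h) - 1)/h], which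
    is bounded uniformly in [h] and [m]. By consistency and boundedness,
    [G P_m (lam y - C y) - P_m y -> 0] first on the core and then on the whole domain of the
    closure [C] of [A + B]. Telescoping along [G P_m U(jh) z] yields
    [F_m(h)^n G P_m z - G P_m U(t) z -> 0] for [z] in [D(C)], hence for all [z]; taking
    [z = lam y - C y] removes [G], and [D(C)] is dense. *)

From Stdlib Require Import Reals ZArith Lra Lia List Classical IndefiniteDescription.
Require Import Defs.
Import ListNotations.
Open Scope R_scope.

Local Notation "x +v y" := (vadd x y) (at level 50, left associativity).
Local Notation "x -v y" := (vsub x y) (at level 50, left associativity).
Local Notation "a *v x" := (vscal a x) (at level 40, left associativity).

(** * Linear arithmetic in Banach spaces *)

(** The first-order expansion of [F_m(h) P_m] is known only on [D(A)] inter [D(B)], which the orbits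
    of [U] may leave, and it does not pass to the closure: approximation in the graph norm of [C]
    leaves an error that the difference quotient [(F_m(h) - 1)/h] multiplies by [1/h]. Once [G] is
    applied, the quotient has been inverted and the same error is multiplied by constants only, so
    consistency is available along whole orbits in [D(C)]. As a finite combination of powers of
    [F_m(h)], [G] commutes with [F_m(h)] and inherits its bound from stability, whereas a resolvent
    of [C] would call for a Laplace integral. Integrals are avoided elsewhere too: the density of
    [D(C)], which is derived from the semigroup [U], and the mean value inequality both rest on
    Riemann sums. Continuity of a semigroup is assumed at time [0] only and no growth bound is given
    for [U], hence the uniform boundedness principle. *)

Lemma vadd_cancel_r (X : Banach) (x y z : X) : x +v z = y +v z -> x = y.
Proof.
  intros H. rewrite <- (vadd_zero _ x), <- (vadd_zero _ y), <- (vadd_opp _ z).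
  now rewrite !vadd_assoc, H.
Qed.

Lemma vscal_0_l (X : Banach) (x : X) : 0 *v x = vzero.
Proof.
  apply (vadd_cancel_r _ _ _ (0 *v x)).
  rewrite <- vscal_distr_r, Rplus_0_r, vadd_comm. symmetry; apply vadd_zero.
Qed.

Lemma vscal_0_r (X : Banach) (a : R) : a *v (vzero : X) = vzero.
Proof. now rewrite <- (vscal_0_l X vzero), vscal_assoc, Rmult_0_r. Qed.

Lemma vopp_scal (X : Banach) (x : X) : vopp x = (-1) *v x.
Proof.
  apply (vadd_cancel_r _ _ _ x). rewrite vadd_comm, vadd_opp.
  rewrite <- (vscal_one _ x) at 2. rewrite <- vscal_distr_r.
  replace (-1 + 1) with 0 by lra. symmetry; apply vscal_0_l.
Qed.

(** * Formal linear combinations and their normalisation by reflection *)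

Inductive vexpr :=
| VZero | VAtom (i : nat) | VAdd (e f : vexpr) | VSub (e f : vexpr)
| VOpp (e : vexpr) | VScal (a : R) (e : vexpr).

Fixpoint veval {X : Banach} (l : list X) (e : vexpr) : X :=
  match e with
  | VZero => vzero
  | VAtom i => nth i l vzero
  | VAdd e f => veval l e +v veval l f
  | VSub e f => veval l e -v veval l f
  | VOpp e => vopp (veval l e)
  | VScal a e => a *v veval l e
  end.

Fixpoint vcoef (e : vexpr) (i : nat) : R :=
  match e with
  | VZero => 0
  | VAtom j => if Nat.eqb i j then 1 else 0
  | VAdd e f => vcoef e i + vcoef f i
  | VSub e f => vcoef e i - vcoef f i
  | VOpp e => - vcoef e i
  | VScal a e => a * vcoef e i
  end.

Fixpoint vcomb {X : Banach} (c : nat -> R) (l : list X) : X :=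
  match l with
  | [] => vzero
  | x :: l => c 0%nat *v x +v vcomb (fun i => c (Datatypes.S i)) l
  end.

Lemma vcomb_ext (X : Banach) (l : list X) (c d : nat -> R) :
  (forall i, (i < length l)%nat -> c i = d i) -> vcomb c l = vcomb d l.
Proof.
  revert c d; induction l as [|x l IH]; intros c d H; simpl in *; [easy|].
  rewrite (H 0%nat) by lia. f_equal. apply IH. intros i Hi; apply H; lia.
Qed.

Lemma vcomb_add (X : Banach) (l : list X) (c d : nat -> R) :
  vcomb (fun i => c i + d i) l = vcomb c l +v vcomb d l.
Proof.
  revert c d; induction l as [|x l IH]; intros c d; simpl.
  - now rewrite vadd_zero.
  - rewrite (IH (fun i => c (Datatypes.S i)) (fun i => d (Datatypes.S i))).
    rewrite vscal_distr_r, !vadd_assoc. f_equal.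
    rewrite <- !vadd_assoc. f_equal. apply vadd_comm.
Qed.

Lemma vcomb_scal (X : Banach) (l : list X) (a : R) (c : nat -> R) :
  vcomb (fun i => a * c i) l = a *v vcomb c l.
Proof.
  revert c; induction l as [|x l IH]; intros c; simpl.
  - now rewrite vscal_0_r.
  - rewrite (IH (fun i => c (Datatypes.S i))).
    now rewrite vscal_distr_l, vscal_assoc.
Qed.

Lemma vcomb_zero (X : Banach) (l : list X) : vcomb (fun _ => 0) l = vzero.
Proof.
  induction l as [|x l IH]; simpl; [easy|]. now rewrite IH, vscal_0_l, vadd_zero.
Qed.

Lemma vcomb_atom (X : Banach) (l : list X) (j : nat) :
  vcomb (fun i => if Nat.eqb i j then 1 else 0) l = nth j l vzero.
Proof.
  revert j; induction l as [|x l IH]; intros [|j]; simpl; try easy.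
  - now rewrite vcomb_zero, vscal_one, vadd_zero.
  - now rewrite IH, vscal_0_l, vadd_comm, vadd_zero.
Qed.

Lemma veval_comb (X : Banach) (l : list X) (e : vexpr) :
  veval l e = vcomb (vcoef e) l.
Proof.
  induction e as [|j|e IHe f IHf|e IHe f IHf|e IHe|a e IHe]; simpl.
  - symmetry; apply vcomb_zero.
  - symmetry; apply vcomb_atom.
  - now rewrite vcomb_add, IHe, IHf.
  - unfold vsub. rewrite vopp_scal, IHe, IHf, <- vcomb_scal, <- vcomb_add.
    apply vcomb_ext; intros; ring.
  - rewrite vopp_scal, IHe, <- vcomb_scal. apply vcomb_ext; intros; ring.
  - now rewrite vcomb_scal, IHe.
Qed.

(** Recursion on the number of atoms, instead of a bounded quantifier, lets [simpl] unfold the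
    premise into a conjunction of scalar equations. *)
Fixpoint vcoefs_agree (e f : vexpr) (n : nat) : Prop :=
  match n with
  | O => True
  | Datatypes.S n => vcoefs_agree e f n /\ vcoef e n = vcoef f n
  end.

Lemma veval_eq (X : Banach) (l : list X) (e f : vexpr) :
  vcoefs_agree e f (length l) -> veval l e = veval l f.
Proof.
  intros H. rewrite !veval_comb. apply vcomb_ext.
  revert H. generalize (length l) as n. induction n as [|n IH]; simpl; intros H i Hi; [lia|].
  destruct (Nat.eq_dec i n) as [->|]; [apply H|]. apply IH; [apply H|lia].
Qed.

Ltac vatom_mem x l :=
  lazymatch l with
  | nil => constr:(false)
  | cons ?y ?t =>
      match constr:(Set) with
      | _ => let _ := match constr:(Set) with _ => constr_eq x y end in constr:(true)
      | _ => vatom_mem x t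
      end
  end.

Ltac vatoms e l :=
  lazymatch e with
  | vzero => l
  | vadd ?a ?b => let l1 := vatoms a l in vatoms b l1
  | vsub ?a ?b => let l1 := vatoms a l in vatoms b l1
  | vopp ?a => vatoms a l
  | vscal _ ?a => vatoms a l
  | _ => lazymatch vatom_mem e l with true => l | false => constr:(cons e l) end
  end.

Ltac vatom_index x l :=
  lazymatch l with
  | cons ?y ?t =>
      match constr:(Set) with
      | _ => let _ := match constr:(Set) with _ => constr_eq x y end in constr:(O)
      | _ => let n := vatom_index x t in constr:(Datatypes.S n)
      end
  end.

Ltac vreify e l :=
  lazymatch e with
  | vzero => constr:(VZero)
  | vadd ?a ?b => let a := vreify a l in let b := vreify b l in constr:(VAdd a b)
  | vsub ?a ?b => let a := vreify a l in let b := vreify b l in constr:(VSub a b)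
  | vopp ?a => let a := vreify a l in constr:(VOpp a)
  | vscal ?c ?a => let a := vreify a l in constr:(VScal c a)
  | _ => let i := vatom_index e l in constr:(VAtom i)
  end.

(* Equality of formal linear combinations, one coefficient per atom. *)
Ltac vring :=
  lazymatch goal with
  | |- @eq (car ?X) ?a ?b =>
      let l := vatoms a (@nil (car X)) in
      let l := vatoms b l in
      let e := vreify a l in
      let f := vreify b l in
      change (@veval X l e = @veval X l f);
      apply veval_eq; simpl; repeat split; try ring; try (field; lra)
  end.

(** * Norm inequalities, linear maps and limits *)

Lemma vnorm_zero (X : Banach) : vnorm (vzero : X) = 0.
Proof. rewrite <- (vscal_0_l X vzero), vnorm_scal, Rabs_R0. ring. Qed.

Lemma vnorm_opp (X : Banach) (x : X) : vnorm (vopp x) = vnorm x.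
Proof. rewrite vopp_scal, vnorm_scal, Rabs_left by lra. ring. Qed.

Lemma vnorm_sub_sym (X : Banach) (x y : X) : vnorm (x -v y) = vnorm (y -v x).
Proof. rewrite <- vnorm_opp. f_equal. vring. Qed.

Lemma vnorm_sub_le (X : Banach) (x y : X) : vnorm (x -v y) <= vnorm x + vnorm y.
Proof. rewrite <- (vnorm_opp _ y). apply vnorm_triangle. Qed.

Lemma vnorm_dist_triangle (X : Banach) (y x z : X) :
  vnorm (x -v z) <= vnorm (x -v y) + vnorm (y -v z).
Proof.
  replace (x -v z) with ((x -v y) +v (y -v z)) by vring. apply vnorm_triangle.
Qed.

Lemma vnorm_add_le (X : Banach) (x y : X) (a b : R) :
  vnorm x <= a -> vnorm y <= b -> vnorm (x +v y) <= a + b.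
Proof. intros Hx Hy. pose proof (vnorm_triangle _ x y). lra. Qed.

Lemma vnorm_le_add (X : Banach) (x y : X) : vnorm x <= vnorm y + vnorm (x -v y).
Proof. replace x with (y +v (x -v y)) at 1 by vring. apply vnorm_triangle. Qed.

Lemma vnorm_scal_pos (X : Banach) (a : R) (x : X) :
  0 <= a -> vnorm (a *v x) = a * vnorm x.
Proof. intros Ha. now rewrite vnorm_scal, Rabs_pos_eq. Qed.

Lemma vsub_eq_zero (X : Banach) (x y : X) : vnorm (x -v y) <= 0 -> x = y.
Proof.
  intros H. assert (H0 : x -v y = vzero).
  { apply vnorm_eq0. pose proof (vnorm_nonneg _ (x -v y)). lra. }
  replace x with ((x -v y) +v y) by vring. rewrite H0. vring.
Qed.

Section Linear.
Context {X Y : Banach} {f : X -> Y} (Hf : is_linear f).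

Lemma lin_add x y : f (x +v y) = f x +v f y.
Proof. apply Hf. Qed.

Lemma lin_scal a x : f (a *v x) = a *v f x.
Proof. apply Hf. Qed.

Lemma lin_sub x y : f (x -v y) = f x -v f y.
Proof.
  replace (x -v y) with (x +v (-1) *v y) by vring. rewrite lin_add, lin_scal. vring.
Qed.

Lemma lin_zero : f vzero = vzero.
Proof. rewrite <- (vscal_0_l X vzero), lin_scal. vring. Qed.

End Linear.

Lemma lin_comp (X Y Z : Banach) (g : Y -> Z) (f : X -> Y) :
  is_linear g -> is_linear f -> is_linear (fun x => g (f x)).
Proof.
  intros Hg Hf. split; intros.
  - now rewrite (lin_add Hf), (lin_add Hg).
  - now rewrite (lin_scal Hf), (lin_scal Hg).
Qed.

Lemma lin_iter (X : Banach) (f : X -> X) (k : nat) :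
  is_linear f -> is_linear (Nat.iter k f).
Proof.
  intros Hf. induction k as [|k IH]; [now split|]. exact (lin_comp _ _ _ _ _ Hf IH).
Qed.

Lemma iter_shift (T : Type) (f : T -> T) (k : nat) (x : T) :
  Nat.iter k f (f x) = f (Nat.iter k f x).
Proof. induction k as [|k IH]; simpl; [easy|]. now rewrite IH. Qed.

Lemma bounded_linear_nonneg (X Y : Banach) (f : X -> Y) :
  is_bounded_linear f -> exists C, 0 < C /\ forall x, vnorm (f x) <= C * vnorm x.
Proof.
  intros [_ [C HC]]. exists (Rmax C 1). split; [pose proof (Rmax_r C 1); lra|].
  intros x. eapply Rle_trans; [apply HC|].
  apply Rmult_le_compat_r; [apply vnorm_nonneg|apply Rmax_l].
Qed.

Lemma seq_lim_dist_le (X : Banach) (u : nat -> X) (l y : X) (C : R) (K : nat) :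
  seq_lim u l -> (forall k, (K <= k)%nat -> vnorm (u k -v y) <= C) ->
  vnorm (l -v y) <= C.
Proof.
  intros Hu HC. apply le_epsilon; intros eps Heps. destruct (Hu eps Heps) as [N HN].
  specialize (HN (Nat.max K N) ltac:(lia)). specialize (HC (Nat.max K N) ltac:(lia)).
  pose proof (vnorm_dist_triangle _ (u (Nat.max K N)) l y).
  rewrite (vnorm_sub_sym _ l (u _)) in H. lra.
Qed.

Lemma rlim0_unique (X : Banach) (f : R -> X) (l l' : X) :
  rlim0 f l -> rlim0 f l' -> l = l'.
Proof.
  intros H H'. apply vsub_eq_zero, le_epsilon; intros eps Heps.
  destruct (H (eps / 2) ltac:(lra)) as [d [Hd Hl]].
  destruct (H' (eps / 2) ltac:(lra)) as [d' [Hd' Hl']].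
  set (h := Rmin d d' / 2).
  assert (Hh : 0 < h < d /\ h < d').
  { pose proof (Rmin_l d d'); pose proof (Rmin_r d d').
    pose proof (Rmin_glb_lt d d' 0 Hd Hd'). unfold h; lra. }
  specialize (Hl h ltac:(lra)). specialize (Hl' h ltac:(lra)).
  pose proof (vnorm_dist_triangle _ (f h) l l'). rewrite (vnorm_sub_sym _ l (f h)) in H0. lra.
Qed.

(** * Uniform boundedness *)

Lemma eventually_bounded (u : nat -> R) (N : nat) (C : R) :
  (forall n, (N <= n)%nat -> u n <= C) -> exists C', forall n, u n <= C'.
Proof.
  revert C; induction N as [|N IH]; intros C H.
  - exists C. intros n; apply H; lia.
  - apply (IH (Rmax C (u N))). intros n Hn. destruct (Nat.eq_dec n N) as [->|].
    + apply Rmax_r.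
    + eapply Rle_trans; [apply H; lia|apply Rmax_l].
Qed.

(* Nested balls: if no uniform bound exists, each ball contains a smaller one on
   which some [f i] exceeds any prescribed level. *)
Lemma uniform_boundedness (X Y : Banach) (I : Type) (f : I -> X -> Y) :
  (forall i, is_bounded_linear (f i)) ->
  (forall x, exists C, forall i, vnorm (f i x) <= C) ->
  exists C, forall i x, vnorm (f i x) <= C * vnorm x.
Proof.
  intros Hf Hpt. apply NNPP; intros Hno.
  set (good := fun (k : nat) (p q : X * R) =>
    0 < snd q <= snd p / 2 /\ vnorm (fst q -v fst p) <= snd p / 2 /\
    exists i, forall z, vnorm (z -v fst q) <= snd q -> INR k < vnorm (f i z)).
  assert (Hstep : forall k p, exists q, 0 < snd p -> good k p q).
  { intros k [x r]. destruct (Rlt_dec 0 r) as [Hr|Hr]; [|exists (x, r); simpl; lra].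
    destruct (classic (exists i y, vnorm (y -v x) <= r / 2 /\ INR k < vnorm (f i y)))
      as [[i [y [Hy Hk]]]|Hsmall].
    - destruct (bounded_linear_nonneg _ _ _ (Hf i)) as [C [HC HfC]].
      (* On a ball of this radius [f i] varies by at most half of the gap [vnorm (f i y) - INR k],
         so its norm stays above [INR k]. *)
      set (r' := Rmin (r / 2) ((vnorm (f i y) - INR k) / (2 * C))).
      assert (Hgap : 0 < (vnorm (f i y) - INR k) / (2 * C)).
      { apply Rdiv_lt_0_compat; lra. }
      assert (Hr' : 0 < r') by (apply Rmin_glb_lt; lra).
      exists (y, r'). intros _. unfold good; simpl. repeat split; try easy.
      + apply Rmin_l.
      + exists i. intros z Hz.
        assert (H1 : vnorm (f i z -v f i y) <= (vnorm (f i y) - INR k) / 2).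
        { rewrite <- (lin_sub (proj1 (Hf i))). eapply Rle_trans; [apply HfC|].
          replace ((vnorm (f i y) - INR k) / 2)
            with (C * ((vnorm (f i y) - INR k) / (2 * C))) by (field; lra).
          apply Rmult_le_compat_l; [lra|]. eapply Rle_trans; [apply Hz|apply Rmin_r]. }
        pose proof (vnorm_le_add _ (f i y) (f i z)). rewrite (vnorm_sub_sym _ (f i y)) in H. lra.
    (* If every [f i] were bounded by [INR k] on the ball of radius [r / 2] about [x], then scaling
       [v] to length [r / 2] and writing [f i v] as a multiple of [f i y -v f i x] would give the
       uniform bound [4 * INR k / r]. *)
    - exfalso. apply Hno.
      assert (Hball : forall i y, vnorm (y -v x) <= r / 2 -> vnorm (f i y) <= INR k).
      { intros i y Hy. apply Rnot_lt_le. intros Hlt. apply Hsmall. now exists i, y. }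
      exists (4 * INR k / r). intros i v. pose proof (vnorm_nonneg _ v) as Hv.
      destruct (Req_dec (vnorm v) 0) as [H0|H0].
      + apply vnorm_eq0 in H0; subst v. rewrite (lin_zero (proj1 (Hf i))), !vnorm_zero. lra.
      + set (y := x +v (r / (2 * vnorm v)) *v v).
        assert (Hy : vnorm (f i y) <= INR k).
        { apply Hball. unfold y.
          replace (x +v (r / (2 * vnorm v)) *v v -v x) with ((r / (2 * vnorm v)) *v v) by vring.
          rewrite vnorm_scal_pos by (apply Rlt_le, Rdiv_lt_0_compat; lra).
          apply Req_le. field. lra. }
        assert (Hx : vnorm (f i x) <= INR k).
        { apply Hball. replace (x -v x) with (vzero : X) by vring. rewrite vnorm_zero. lra. }
        replace (f i v) with ((2 * vnorm v / r) *v (f i y -v f i x)).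
        * rewrite vnorm_scal_pos by (apply Rlt_le, Rdiv_lt_0_compat; lra).
          replace (4 * INR k / r * vnorm v) with (2 * vnorm v / r * (INR k + INR k))
            by (field; lra).
          apply Rmult_le_compat_l; [apply Rlt_le, Rdiv_lt_0_compat; lra|].
          eapply Rle_trans; [apply vnorm_sub_le|lra].
        * unfold y. rewrite (lin_add (proj1 (Hf i))), (lin_scal (proj1 (Hf i))). vring. }
  set (next := fun k p => proj1_sig (constructive_indefinite_description _ (Hstep k p))).
  assert (Hnext : forall k p, 0 < snd p -> good k p (next k p)).
  { intros k p. unfold next. now destruct (constructive_indefinite_description _ (Hstep k p)). }
  set (b := fix b (n : nat) : X * R :=
    match n with O => (vzero, 1) | Datatypes.S n => next n (b n) end).
  assert (Hpos : forall n, 0 < snd (b n)).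
  { induction n as [|n IH]; simpl; [lra|]. apply (Hnext n (b n) IH). }
  assert (Hgood : forall n, good n (b n) (b (Datatypes.S n))) by (intros n; now apply Hnext).
  (* The shift of the centre and the new radius are each at most half of the old radius, so the
     shift is at most the drop in radius, and the drops telescope. *)
  assert (Hdist : forall j n, vnorm (fst (b (n + j)%nat) -v fst (b n)) <= snd (b n) - snd (b (n + j)%nat)).
  { induction j as [|j IH]; intros n.
    - rewrite Nat.add_0_r. replace (_ -v _) with (vzero : X) by vring. rewrite vnorm_zero. lra.
    - rewrite Nat.add_succ_r. destruct (Hgood (n + j)%nat) as [H1 [H2 _]].
      pose proof (vnorm_dist_triangle _ (fst (b (n + j)%nat)) (fst (b (Datatypes.S (n + j)))) (fst (b n))).
      specialize (IH n). lra. }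
  assert (Hrad : forall n, snd (b n) <= (1 / 2) ^ n).
  { induction n as [|n IH]; [simpl; lra|]. destruct (Hgood n) as [H1 _].
    rewrite <- tech_pow_Rmult. lra. }
  destruct (vcomplete X (fun n => fst (b n))) as [l Hl].
  { intros eps Heps.
    destruct (pow_lt_1_zero (1 / 2) ltac:(rewrite Rabs_pos_eq; lra) (eps / 2) ltac:(lra)) as [N HN].
    assert (HNr : snd (b N) < eps / 2).
    { eapply Rle_lt_trans; [apply Hrad|]. specialize (HN N ltac:(lia)).
      rewrite Rabs_pos_eq in HN; [easy|]. apply pow_le; lra. }
    exists N. intros p q Hp Hq. fold (fst (b p) -v fst (b q)).
    pose proof (Hdist (p - N)%nat N) as H1. pose proof (Hdist (q - N)%nat N) as H2.
    replace (N + (p - N))%nat with p in H1 by lia. replace (N + (q - N))%nat with q in H2 by lia.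
    pose proof (vnorm_dist_triangle _ (fst (b N)) (fst (b p)) (fst (b q))) as H3.
    rewrite (vnorm_sub_sym _ (fst (b N)) (fst (b q))) in H3.
    pose proof (Hpos p); pose proof (Hpos q). lra. }
  destruct (Hpt l) as [C HC]. destruct (INR_unbounded C) as [k Hk].
  destruct (Hgood k) as [_ [_ [i Hi]]].
  specialize (Hi l). specialize (HC i).
  assert (Hin : vnorm (l -v fst (b (Datatypes.S k))) <= snd (b (Datatypes.S k))).
  { apply (seq_lim_dist_le _ _ _ _ _ (Datatypes.S k) Hl). intros n Hn.
    pose proof (Hdist (n - Datatypes.S k)%nat (Datatypes.S k)) as H1.
    replace (Datatypes.S k + (n - Datatypes.S k))%nat with n in H1 by lia.
    pose proof (Hpos n). lra. }
  specialize (Hi Hin). lra.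
Qed.
(** * Strongly continuous semigroups *)

Lemma nat_floor (h d : R) : 0 <= h -> 0 < d ->
  exists i : nat, INR i * d <= h < (INR i + 1) * d.
Proof.
  intros Hh Hd. destruct (base_Int_part (h / d)) as [H1 H2].
  assert (Hq : 0 <= h / d) by (apply Rmult_le_pos; [lra|apply Rlt_le, Rinv_0_lt_compat, Hd]).
  assert (Hz : (0 <= Int_part (h / d))%Z).
  { apply Z.lt_succ_r. apply lt_IZR. rewrite succ_IZR. lra. }
  exists (Z.to_nat (Int_part (h / d))). rewrite INR_IZR_INZ, Z2Nat.id by easy.
  replace h with (h / d * d) at 2 3 by (field; lra).
  split; [apply Rmult_le_compat_r|apply Rmult_lt_compat_r]; lra.
Qed.

(** The graph of the generator of [U], kept as a relation so that no [Op] has to be fixed. *)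
Definition orbit_deriv {X : Banach} (U : R -> X -> X) (x y : X) : Prop :=
  rlim0 (fun h => / h *v (U h x -v x)) y.

Section Semigroup.
Context {X : Banach} {U : R -> X -> X} (HU : is_C0_semigroup U).

Lemma sg_lin t : 0 <= t -> is_linear (U t).
Proof. intros Ht. apply HU, Ht. Qed.

Lemma sg_zero x : U 0 x = x.
Proof. apply HU. Qed.

Lemma sg_add s t x : 0 <= s -> 0 <= t -> U (s + t) x = U s (U t x).
Proof. apply HU. Qed.

Lemma sg_right_continuous x eps : 0 < eps ->
  exists d, 0 < d /\ forall s, 0 <= s < d -> vnorm (U s x -v x) < eps.
Proof.
  intros Heps. destruct HU as [_ [_ [_ Hc]]]. destruct (Hc x eps Heps) as [d [Hd H]].
  exists d. split; [easy|]. intros s Hs. destruct (Req_dec s 0) as [->|Hne].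
  - rewrite sg_zero. replace (x -v x) with (vzero : X) by vring. now rewrite vnorm_zero.
  - apply H. lra.
Qed.

(** Otherwise there are times [s n] tending to [0] at which the operator norm exceeds [n]. By
    continuity at [0] the operators [U (s n)] are pointwise bounded, which contradicts uniform
    boundedness. *)
Lemma sg_bounded_near_zero :
  exists d C, 0 < d /\ forall s x, 0 <= s <= d -> vnorm (U s x) <= C * vnorm x.
Proof.
  apply NNPP; intros Hno.
  assert (Hs : forall n : nat, exists s, 0 <= s <= / (INR n + 1) /\
                exists x, INR n * vnorm x < vnorm (U s x)).
  { intros n. apply NNPP; intros Hn. apply Hno. exists (/ (INR n + 1)), (INR n).
    split; [apply Rinv_0_lt_compat; pose proof (pos_INR n); lra|].
    intros s x Hs. apply Rnot_lt_le; intros Hlt. apply Hn. exists s. split; [easy|]. now exists x. }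
  set (s := fun n => proj1_sig (constructive_indefinite_description _ (Hs n))).
  assert (Hs' : forall n, 0 <= s n <= / (INR n + 1) /\
                exists x, INR n * vnorm x < vnorm (U (s n) x)).
  { intros n. unfold s. now destruct (constructive_indefinite_description _ (Hs n)). }
  clearbody s. destruct (uniform_boundedness X X nat (fun n => U (s n))) as [C HC].
  - intros n. apply HU, Hs'.
  - intros x. destruct (sg_right_continuous x 1 ltac:(lra)) as [d [Hd H]].
    destruct (INR_unbounded (/ d)) as [N HN].
    apply (eventually_bounded _ N (vnorm x + 1)). intros n Hn.
    eapply Rle_trans; [apply (vnorm_le_add _ _ x)|]. apply Rplus_le_compat_l, Rlt_le, H.
    destruct (Hs' n) as [[Hs1 Hs2] _]. split; [easy|]. eapply Rle_lt_trans; [apply Hs2|].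
    rewrite <- (Rinv_inv d). apply Rinv_lt_contravar.
    + apply Rmult_lt_0_compat; [now apply Rinv_0_lt_compat|pose proof (pos_INR n); lra].
    + apply le_INR in Hn. lra.
  - destruct (INR_unbounded C) as [n Hn]. destruct (Hs' n) as [_ [x Hx]].
    specialize (HC n x). simpl in HC. pose proof (vnorm_nonneg _ x). nra.
Qed.

Lemma sg_locally_bounded t :
  exists C, 1 <= C /\ forall s x, 0 <= s <= t -> vnorm (U s x) <= C * vnorm x.
Proof.
  destruct sg_bounded_near_zero as [d [C0 [Hd HC0]]].
  assert (Hn : forall n : nat, exists C, 1 <= C /\
            forall s x, 0 <= s <= INR n * d -> vnorm (U s x) <= C * vnorm x).
  { induction n as [|n [C [HC IH]]].
    - exists 1. split; [lra|]. intros s x Hs. simpl in Hs.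
      replace s with 0 by lra. rewrite sg_zero. lra.
    - exists (Rmax 1 C0 * C). pose proof (Rmax_l 1 C0); pose proof (Rmax_r 1 C0).
      split; [nra|]. intros s x Hs. rewrite S_INR in Hs.
      pose proof (vnorm_nonneg _ x) as Hx.
      destruct (Rle_dec s d) as [Hsd|Hsd].
      + eapply Rle_trans; [apply HC0; lra|]. apply Rmult_le_compat_r; [easy|nra].
      + replace s with (d + (s - d)) by ring. rewrite sg_add by lra.
        eapply Rle_trans; [apply HC0; lra|]. rewrite Rmult_assoc.
        specialize (IH (s - d) x ltac:(lra)). pose proof (vnorm_nonneg _ (U (s - d) x)).
        eapply Rle_trans; [apply Rmult_le_compat_r; [easy|apply H0]|].
        apply Rmult_le_compat_l; lra. }
  destruct (Rle_dec 0 t) as [Ht|Ht].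
  - destruct (nat_floor t d Ht Hd) as [i Hi]. destruct (Hn (Datatypes.S i)) as [C [HC H]].
    exists C. split; [easy|]. intros s x Hs. apply H. rewrite S_INR. lra.
  - exists 1. split; [lra|]. intros; lra.
Qed.

Lemma sg_sub s s' x : 0 <= s <= s' -> U s' x -v U s x = U s (U (s' - s) x -v x).
Proof.
  intros Hs. rewrite (lin_sub (sg_lin s ltac:(lra))), <- sg_add by lra.
  now replace (s + (s' - s)) with s' by ring.
Qed.

Lemma orbit_deriv_expansion x y eps : orbit_deriv U x y -> 0 < eps ->
  exists d, 0 < d /\ forall h, 0 <= h < d -> vnorm (U h x -v x -v h *v y) <= eps * h.
Proof.
  intros H Heps. destruct (H eps Heps) as [d [Hd Hh]]. exists d. split; [easy|].
  intros h Hhd. destruct (Req_dec h 0) as [->|Hne].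
  - rewrite sg_zero. replace (_ -v _) with (vzero : X) by vring. rewrite vnorm_zero. lra.
  - specialize (Hh h ltac:(lra)). assert (0 < h) by lra.
    replace (U h x -v x -v h *v y) with (h *v (/ h *v (U h x -v x) -v y)) by vring.
    rewrite vnorm_scal_pos by lra. nra.
Qed.

Lemma orbit_deriv_intro x y :
  (forall eps, 0 < eps -> exists d, 0 < d /\
     forall h, 0 < h < d -> vnorm (U h x -v x -v h *v y) <= eps * h) ->
  orbit_deriv U x y.
Proof.
  intros H eps Heps. destruct (H (eps / 2) ltac:(lra)) as [d [Hd Hh]].
  exists d. split; [easy|]. intros h Hhd. specialize (Hh h Hhd).
  replace (/ h *v (U h x -v x) -v y) with (/ h *v (U h x -v x -v h *v y)) by vring.
  assert (Hi : 0 < / h) by (apply Rinv_0_lt_compat; lra).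
  rewrite vnorm_scal_pos by lra.
  apply Rle_lt_trans with (/ h * (eps / 2 * h)); [apply Rmult_le_compat_l; lra|].
  replace (/ h * (eps / 2 * h)) with (eps / 2) by (field; lra). lra.
Qed.

Lemma orbit_deriv_orbit s x y : 0 <= s ->
  orbit_deriv U x y -> orbit_deriv U (U s x) (U s y).
Proof.
  intros Hs H. destruct HU as [Hb _].
  destruct (bounded_linear_nonneg _ _ _ (Hb s Hs)) as [C [HC HUC]].
  apply orbit_deriv_intro. intros eps Heps.
  destruct (orbit_deriv_expansion x y (eps / C) H ltac:(now apply Rdiv_lt_0_compat)) as [d [Hd He]].
  exists d. split; [easy|]. intros h Hh.
  rewrite <- sg_add, Rplus_comm, sg_add by lra.
  rewrite <- (lin_scal (sg_lin s Hs)), <- !(lin_sub (sg_lin s Hs)).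
  eapply Rle_trans; [apply HUC|]. specialize (He h ltac:(lra)).
  replace (eps * h) with (C * (eps / C * h)) by (field; lra).
  apply Rmult_le_compat_l; lra.
Qed.

(** Times [d], this is the left Riemann sum of the orbit of [x] over [[0, n d]]. *)
Fixpoint orbit_sum (x : X) (d : R) (n : nat) : X :=
  match n with
  | O => vzero
  | Datatypes.S n => orbit_sum x d n +v U (INR n * d) x
  end.

Lemma orbit_sum_add x d p q : 0 <= d ->
  orbit_sum x d (p + q) = orbit_sum x d p +v U (INR p * d) (orbit_sum x d q).
Proof.
  intros Hd. assert (Hp : 0 <= INR p * d) by (apply Rmult_le_pos; [apply pos_INR|easy]).
  induction q as [|q IH].
  - rewrite Nat.add_0_r. simpl. rewrite (lin_zero (sg_lin _ Hp)). vring.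
  - rewrite Nat.add_succ_r. simpl.
    rewrite (lin_add (sg_lin _ Hp)), IH, plus_INR, Rmult_plus_distr_r, sg_add;
      [vring|easy|apply Rmult_le_pos; [apply pos_INR|easy]].
Qed.

Lemma orbit_sum_near x d n e :
  (forall i, (i < n)%nat -> vnorm (U (INR i * d) x -v x) <= e) ->
  vnorm (orbit_sum x d n -v INR n *v x) <= INR n * e.
Proof.
  induction n as [|n IH]; intros H.
  - simpl. replace (_ -v _) with (vzero : X) by vring. rewrite vnorm_zero. lra.
  - rewrite S_INR. simpl orbit_sum.
    replace (_ -v _) with ((orbit_sum x d n -v INR n *v x) +v (U (INR n * d) x -v x)) by vring.
    eapply Rle_trans; [apply vnorm_triangle|].
    specialize (IH ltac:(intros; apply H; lia)). specialize (H n ltac:(lia)). lra.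
Qed.

(** The fine sum over a coarse cell is the fine sum over the first cell, moved by [U]. So the error
    is estimated near time [0] only and costs a factor [C] in each of the [b] cells. *)
Lemma orbit_sum_refine x d a b e C : 0 <= d -> 0 <= C -> 0 <= e ->
  (forall s z, 0 <= s <= INR b * INR a * d -> vnorm (U s z) <= C * vnorm z) ->
  (forall i, (i < a)%nat -> vnorm (U (INR i * d) x -v x) <= e) ->
  vnorm (orbit_sum x d (a * b) -v INR a *v orbit_sum x (INR a * d) b) <= INR b * (C * (INR a * e)).
Proof.
  intros Hd HC He. pose proof (pos_INR a) as Ha.
  assert (Had : 0 <= INR a * d) by now apply Rmult_le_pos.
  induction b as [|b IH]; intros HUC H.
  - rewrite Nat.mul_0_r. simpl. replace (_ -v _) with (vzero : X) by vring.
    rewrite vnorm_zero. lra.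
  - rewrite Nat.mul_succ_r, orbit_sum_add by easy. simpl orbit_sum. rewrite mult_INR.
    rewrite S_INR in *. pose proof (pos_INR b) as Hb.
    replace (INR a * INR b * d) with (INR b * (INR a * d)) by ring.
    assert (Hs : 0 <= INR b * (INR a * d)) by now apply Rmult_le_pos.
    replace (_ -v _) with
      ((orbit_sum x d (a * b) -v INR a *v orbit_sum x (INR a * d) b) +v
       U (INR b * (INR a * d)) (orbit_sum x d a -v INR a *v x))
      by (rewrite (lin_sub (sg_lin _ Hs)), (lin_scal (sg_lin _ Hs)); vring).
    eapply Rle_trans; [apply vnorm_triangle|].
    assert (H1 := IH ltac:(intros s z Hsz; apply HUC; nra) H).
    assert (H2 : vnorm (U (INR b * (INR a * d)) (orbit_sum x d a -v INR a *v x)) <= C * (INR a * e)).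
    { eapply Rle_trans; [apply HUC; nra|]. apply Rmult_le_compat_l; [easy|].
      now apply orbit_sum_near. }
    lra.
Qed.

(* [y] is the mean of the orbit of [x] over [0, tau], as a limit of dyadic Riemann sums;
   its orbit has derivative [(U tau x - x) / tau] at [0]. *)
Lemma generator_dense x eps : 0 < eps ->
  exists y z, orbit_deriv U y z /\ vnorm (y -v x) <= eps.
Proof.
  (* The horizon [2] covers [tau <= 1] and, below, [h' <= h + d] with [h < 1] and [d <= 1]. *)
  intros Heps. destruct (sg_locally_bounded 2) as [C [HC HUC]].
  destruct (sg_right_continuous x (eps / C) ltac:(apply Rdiv_lt_0_compat; lra)) as [d0 [Hd0 Hsmall]].
  set (tau := Rmin 1 (d0 / 2)).
  assert (Htau : 0 < tau <= 1 /\ tau < d0).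
  { pose proof (Rmin_l 1 (d0 / 2)); pose proof (Rmin_r 1 (d0 / 2)).
    pose proof (Rmin_glb_lt 1 (d0 / 2) 0 ltac:(lra) ltac:(lra)). unfold tau; lra. }
  clearbody tau.
  (* Powers of two make each mesh a refinement of all earlier ones, so that [orbit_sum_refine]
     compares any two of the means. *)
  set (N := fun n => (2 ^ n)%nat).
  assert (HN : forall n, 1 <= INR (N n)).
  { intros n. apply (le_INR 1). unfold N. induction n; simpl; lia. }
  set (y := fun n => / INR (N n) *v orbit_sum x (tau / INR (N n)) (N n)).
  assert (Hy : forall n k e, (n <= k)%nat -> 0 <= e ->
    (forall s, 0 <= s < tau / INR (N n) -> vnorm (U s x -v x) <= e) ->
    vnorm (y k -v y n) <= C * e).
  { intros n k e Hnk He Hs. pose proof (HN n); pose proof (HN k).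
    assert (Hk : N k = (N (k - n) * N n)%nat).
    { unfold N. rewrite <- Nat.pow_add_r. f_equal. lia. }
    pose proof (HN (k - n)%nat) as Hkn. apply (f_equal INR) in Hk as HkR. rewrite mult_INR in HkR.
    assert (Hd : 0 < tau / INR (N k)) by (apply Rdiv_lt_0_compat; lra).
    assert (Hdd : INR (N (k - n)%nat) * (tau / INR (N k)) = tau / INR (N n)).
    { rewrite HkR. field. lra. }
    pose proof (orbit_sum_refine x (tau / INR (N k)) (N (k - n)%nat) (N n) e C ltac:(lra) ltac:(lra) He) as Href.
    rewrite <- Hk, Hdd in Href.
    replace (y k -v y n) with (/ INR (N k) *v
      (orbit_sum x (tau / INR (N k)) (N k) -v INR (N (k - n)%nat) *v orbit_sum x (tau / INR (N n)) (N n))).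
    - rewrite vnorm_scal_pos by (apply Rlt_le, Rinv_0_lt_compat; lra).
      replace (C * e) with (/ INR (N k) * (INR (N n) * (C * (INR (N (k - n)%nat) * e)))).
      + apply Rmult_le_compat_l; [apply Rlt_le, Rinv_0_lt_compat; lra|].
        apply Href.
        * intros s z Hsz. apply HUC. rewrite Rmult_assoc, Hdd in Hsz.
          replace (INR (N n) * (tau / INR (N n))) with tau in Hsz by (field; lra). lra.
        * intros i Hi. apply Hs. rewrite <- Hdd. apply lt_INR in Hi. pose proof (pos_INR i).
          split; [apply Rmult_le_pos; lra|apply Rmult_lt_compat_r; lra].
      + rewrite HkR. field. lra.
    - unfold y. rewrite HkR. vring. }
  assert (Hmesh : forall d, 0 < d -> exists n, forall k, (n <= k)%nat -> tau / INR (N k) < d).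
  { intros d Hd.
    destruct (pow_lt_1_zero (/ 2) ltac:(rewrite Rabs_pos_eq; lra) d Hd) as [n Hn].
    exists n. intros k Hk. specialize (Hn k Hk). rewrite Rabs_pos_eq in Hn by (apply pow_le; lra).
    unfold N. rewrite pow_INR. simpl INR. replace (1 + 1) with 2 by ring.
    rewrite pow_inv in Hn. unfold Rdiv.
    assert (0 < / 2 ^ k) by (apply Rinv_0_lt_compat, pow_lt; lra). nra. }
  destruct (vcomplete X y) as [l Hl].
  { intros r Hr.
    destruct (sg_right_continuous x (r / (4 * C)) ltac:(apply Rdiv_lt_0_compat; lra)) as [d [Hd H]].
    destruct (Hmesh d Hd) as [n Hn]. exists n. intros p q Hp Hq. fold (y p -v y q).
    assert (Hr4 : 0 < r / (4 * C)) by (apply Rdiv_lt_0_compat; lra).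
    assert (Hb : forall k, (n <= k)%nat -> vnorm (y k -v y n) <= r / 4).
    { intros k Hk. replace (r / 4) with (C * (r / (4 * C))) by (field; lra).
      apply Hy; [easy|lra|]. intros s Hs. apply Rlt_le, H. specialize (Hn n (le_n n)). lra. }
    pose proof (Hb p Hp). pose proof (Hb q Hq).
    pose proof (vnorm_dist_triangle _ (y n) (y p) (y q)) as Ht.
    rewrite (vnorm_sub_sym _ (y n) (y q)) in Ht. lra. }
  exists l, (/ tau *v (U tau x -v x)). split.
  - apply orbit_deriv_intro. intros r Hr.
    (* Chosen so that [(C + 1) * (INR j * e) / INR (N n)] equals [r * h'] in [Hmain]. *)
    set (e := r * tau / (C + 1)).
    assert (He : 0 < e) by (apply Rdiv_lt_0_compat; [apply Rmult_lt_0_compat|]; lra).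
    destruct (sg_right_continuous x e He) as [d1 [Hd1 H1]].
    exists (Rmin 1 (d1 / 2)). split; [apply Rmin_glb_lt; lra|]. intros h Hh.
    assert (Hh1 : h < 1 /\ h < d1 / 2).
    { pose proof (Rmin_l 1 (d1 / 2)); pose proof (Rmin_r 1 (d1 / 2)); lra. }
    set (c := / tau *v (U tau x -v x)).
    (* For fixed [h], the slack [g] pays for replacing [l] by [y n] and [h] by the grid time [h'].
       The denominator of [g'] adds up the weights of these errors in the final estimate. *)
    apply le_epsilon. intros g Hg.
    set (g' := g / (2 * C + 1 + vnorm c + r)).
    pose proof (vnorm_nonneg _ c) as Hc.
    assert (Hg' : 0 < g') by (apply Rdiv_lt_0_compat; lra).
    destruct (sg_right_continuous l g' Hg') as [d2 [Hd2 H2]].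
    destruct (Hl g' Hg') as [n1 Hn1].
    destruct (Hmesh (Rmin (Rmin g' d2) (d1 / 2))) as [n2 Hn2].
    { apply Rmin_glb_lt; [now apply Rmin_glb_lt|lra]. }
    set (n := Nat.max n1 n2). specialize (Hn1 n ltac:(lia)). specialize (Hn2 n ltac:(lia)).
    fold (y n -v l) in Hn1. pose proof (HN n) as HNn.
    set (d := tau / INR (N n)) in *.
    assert (Hd : 0 < d) by (apply Rdiv_lt_0_compat; lra).
    assert (Hdle : d <= 1).
    { unfold d. apply (Rmult_le_reg_r (INR (N n))); [lra|].
      replace (tau / INR (N n) * INR (N n)) with tau by (field; lra). lra. }
    assert (Hd3 : d < g' /\ d < d2 /\ d < d1 / 2).
    { pose proof (Rmin_l (Rmin g' d2) (d1 / 2)); pose proof (Rmin_r (Rmin g' d2) (d1 / 2)).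
      pose proof (Rmin_l g' d2); pose proof (Rmin_r g' d2). lra. }
    destruct (nat_floor h d ltac:(lra) Hd) as [i Hi].
    (* Rounding [h] up to a multiple of the mesh makes the next identity exact. *)
    set (j := Datatypes.S i). set (h' := INR j * d).
    assert (Hh' : h < h' <= h + d).
    { unfold h', j. rewrite S_INR. lra. }
    assert (HNd : INR (N n) * d = tau) by (unfold d; field; lra).
    (* A discrete fundamental theorem of calculus: the orbit sum with [N n + j] terms is split after
       [N n] terms and after [j] terms, and the two results are equated. *)
    assert (Hid : U h' (y n) -v y n
                  = / INR (N n) *v (U tau (orbit_sum x d j) -v orbit_sum x d j)).
    { unfold y. fold d. rewrite (lin_scal (sg_lin h' ltac:(lra))).
      pose proof (orbit_sum_add x d (N n) j ltac:(lra)) as E1.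
      rewrite Nat.add_comm, (orbit_sum_add x d j (N n)) in E1 by lra.
      rewrite HNd in E1. fold h' in E1.
      replace (U h' (orbit_sum x d (N n))) with
        (orbit_sum x d j +v U h' (orbit_sum x d (N n)) -v orbit_sum x d j) by vring.
      rewrite E1. vring. }
    assert (Hmain : vnorm (U h' (y n) -v y n -v h' *v c) <= r * h').
    { rewrite Hid. set (s := orbit_sum x d j).
      replace (/ INR (N n) *v (U tau s -v s) -v h' *v c) with
        (/ INR (N n) *v (U tau (s -v INR j *v x) -v (s -v INR j *v x))).
      - rewrite vnorm_scal_pos by (apply Rlt_le, Rinv_0_lt_compat; lra).
        assert (Hs : vnorm (s -v INR j *v x) <= INR j * e).
        { apply orbit_sum_near. intros k Hk. apply Rlt_le, H1. pose proof (pos_INR k).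
          apply lt_INR in Hk. split; [apply Rmult_le_pos; lra|].
          apply Rlt_trans with h'; [|lra]. now apply Rmult_lt_compat_r. }
        replace (r * h') with (/ INR (N n) * ((C + 1) * (INR j * e))).
        + apply Rmult_le_compat_l; [apply Rlt_le, Rinv_0_lt_compat; lra|].
          eapply Rle_trans; [apply vnorm_sub_le|].
          specialize (HUC tau (s -v INR j *v x) ltac:(lra)). nra.
        + unfold e, h', d. field. lra.
      - rewrite (lin_sub (sg_lin tau ltac:(lra))), (lin_scal (sg_lin tau ltac:(lra))).
        unfold c, h', d. vring. }
    assert (Hcont : vnorm (U h' l -v U h l) <= C * g').
    { rewrite sg_sub by lra. eapply Rle_trans; [apply HUC; lra|].
      apply Rmult_le_compat_l; [lra|]. apply Rlt_le, H2. lra. }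
    assert (HUy : vnorm (U h' (y n) -v U h' l) <= C * g').
    { rewrite <- (lin_sub (sg_lin h' ltac:(lra))). eapply Rle_trans; [apply HUC; lra|].
      apply Rmult_le_compat_l; lra. }
    assert (Hhc : vnorm ((h' - h) *v c) <= g' * vnorm c).
    { rewrite vnorm_scal_pos by lra. apply Rmult_le_compat_r; lra. }
    replace (U h l -v l -v h *v c) with
      ((U h' (y n) -v y n -v h' *v c) -v (U h' (y n) -v U h' l) -v (U h' l -v U h l)
       +v (y n -v l) +v (h' - h) *v c) by vring.
    eapply Rle_trans; [apply vnorm_triangle|].
    eapply Rle_trans; [apply Rplus_le_compat_r, vnorm_triangle|].
    eapply Rle_trans; [apply Rplus_le_compat_r, Rplus_le_compat_r, vnorm_sub_le|].
    eapply Rle_trans; [apply Rplus_le_compat_r, Rplus_le_compat_r, Rplus_le_compat_r, vnorm_sub_le|].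
    assert (Hgg : g = (2 * C + 1 + vnorm c + r) * g') by (unfold g'; field; lra).
    assert (Hrh : r * h' <= r * h + r * g') by nra. nra.
  - apply (seq_lim_dist_le _ _ _ _ _ 0 Hl). intros k _.
    (* The coarsest mesh has the single node [0], so [Hy] compares [x] itself with all later
       means. *)
    assert (Hy0 : y 0%nat = x).
    { unfold y, N. simpl. rewrite Rmult_0_l, sg_zero. vring. }
    rewrite <- Hy0. replace eps with (C * (eps / C)) by (field; lra).
    apply Hy; [lia|apply Rlt_le, Rdiv_lt_0_compat; lra|].
    intros s Hs. apply Rlt_le, Hsmall. simpl in Hs. replace (tau / 1) with tau in Hs by field. lra.
Qed.

End Semigroup.
(* The mean value inequality, with Riemann sums in place of the integral of [U s c]. *)
Lemma sg_mean_value (X : Banach) (U : R -> X -> X) (x c y : X) (h e : R) :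
  is_C0_semigroup U -> orbit_deriv U x c -> 0 <= h ->
  (forall s, 0 <= s <= h -> vnorm (U s c -v y) <= e) ->
  vnorm (U h x -v x -v h *v y) <= e * h.
Proof.
  intros HU Hxc Hh He. destruct (sg_locally_bounded HU h) as [C [HC HUC]].
  apply le_epsilon. intros g Hg. set (e1 := g / (C * (h + 1))).
  assert (HC1 : 0 < C * (h + 1)) by (apply Rmult_lt_0_compat; lra).
  assert (He1 : 0 < e1) by now apply Rdiv_lt_0_compat.
  destruct (orbit_deriv_expansion HU x c e1 Hxc He1) as [d0 [Hd0 Hexp]].
  destruct (INR_unbounded (h / d0)) as [n Hn].
  assert (Hq : 0 <= h / d0) by (apply Rmult_le_pos; [easy|apply Rlt_le, Rinv_0_lt_compat, Hd0]).
  set (d := h / INR n).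
  assert (Hd : 0 <= d < d0).
  { unfold d. split.
    - apply Rmult_le_pos; [easy|apply Rlt_le, Rinv_0_lt_compat; lra].
    - apply (Rmult_lt_reg_r (INR n)); [lra|].
      replace (h / INR n * INR n) with (h / d0 * d0) by (field; lra).
      rewrite (Rmult_comm d0). apply Rmult_lt_compat_r; lra. }
  assert (Hnd : INR n * d = h) by (unfold d; field; lra).
  (* The expansion of the orbit at time [0], transported by [U (INR k * d)], serves at every grid
     point; each step then adds at most [C * e1 * d] to the expected [e * d]. *)
  assert (Hk : forall k, (k <= n)%nat ->
    vnorm (U (INR k * d) x -v x -v (INR k * d) *v y) <= INR k * d * (e + C * e1)).
  { induction k as [|k IH]; intros Hk.
    - simpl. rewrite Rmult_0_l, (sg_zero HU).
      replace (_ -v _) with (vzero : X) by vring. rewrite vnorm_zero. lra.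
    - pose proof (pos_INR k) as Hk0. apply le_INR in Hk as HkR. rewrite S_INR in *.
      specialize (IH ltac:(lia)).
      assert (Hkd : 0 <= INR k * d <= h).
      { split; [apply Rmult_le_pos; lra|]. rewrite <- Hnd. apply Rmult_le_compat_r; lra. }
      replace ((INR k + 1) * d) with (INR k * d + d) by ring. rewrite (sg_add HU) by lra.
      replace (_ -v _) with ((U (INR k * d) x -v x -v (INR k * d) *v y)
        +v d *v (U (INR k * d) c -v y) +v U (INR k * d) (U d x -v x -v d *v c)).
      2:{ rewrite !(lin_sub (sg_lin HU _ (proj1 Hkd))), (lin_scal (sg_lin HU _ (proj1 Hkd))). vring. }
      eapply Rle_trans; [apply vnorm_triangle|].
      eapply Rle_trans; [apply Rplus_le_compat_r, vnorm_triangle|].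
      assert (H1 : vnorm (d *v (U (INR k * d) c -v y)) <= d * e).
      { rewrite vnorm_scal_pos by lra. apply Rmult_le_compat_l; [lra|]. now apply He. }
      assert (H2 : vnorm (U (INR k * d) (U d x -v x -v d *v c)) <= C * (e1 * d)).
      { eapply Rle_trans; [now apply HUC|]. apply Rmult_le_compat_l; [lra|]. now apply Hexp. }
      lra. }
  specialize (Hk n (le_n n)). rewrite Hnd in Hk. eapply Rle_trans; [apply Hk|].
  assert (Hgg : g = C * (h + 1) * e1) by (unfold e1; field; nra).
  rewrite Hgg. nra.
Qed.

(** * Joint limits in the step size and the spatial index *)

Definition jointly (Q : R -> nat -> Prop) : Prop :=
  exists d N, 0 < d /\ forall h m, 0 < h < d -> (N <= m)%nat -> Q h m.

Lemma jointly_mono (Q Q' : R -> nat -> Prop) :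
  jointly Q -> (forall h m, 0 < h -> Q h m -> Q' h m) -> jointly Q'.
Proof.
  intros [d [N [Hd H]]] Himp. exists d, N. split; [easy|].
  intros h m Hh Hm. apply Himp; [lra|]. now apply H.
Qed.

Lemma jointly_and (Q Q' : R -> nat -> Prop) :
  jointly Q -> jointly Q' -> jointly (fun h m => Q h m /\ Q' h m).
Proof.
  intros [d [N [Hd H]]] [d' [N' [Hd' H']]]. exists (Rmin d d'), (Nat.max N N').
  split; [now apply Rmin_glb_lt|]. intros h m Hh Hm.
  pose proof (Rmin_l d d'); pose proof (Rmin_r d d').
  split; [apply H|apply H']; try lra; lia.
Qed.

Lemma jointly_small (d : R) : 0 < d -> jointly (fun h _ => h < d).
Proof. intros Hd. exists d, 0%nat. split; [easy|]. intros; lra. Qed.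

Lemma jointly_large (Q : nat -> Prop) :
  (exists N, forall m, (N <= m)%nat -> Q m) -> jointly (fun _ m => Q m).
Proof. intros [N HN]. exists 1, N. split; [lra|]. intros; now apply HN. Qed.

Lemma jointly_half (Q : R -> nat -> Prop) : jointly Q -> jointly (fun h m => Q (h / 2) m).
Proof.
  intros [d [N [Hd H]]]. exists d, N. split; [easy|]. intros h m Hh Hm. apply H; [lra|easy].
Qed.

Lemma jointly_finite (Q : nat -> R -> nat -> Prop) (n : nat) :
  (forall i, (i < n)%nat -> jointly (Q i)) ->
  jointly (fun h m => forall i, (i < n)%nat -> Q i h m).
Proof.
  induction n as [|n IH]; intros H.
  - exists 1, 0%nat. split; [lra|]. intros; lia.
  - apply (jointly_mono _ _ (jointly_and _ _ (IH ltac:(intros; apply H; lia)) (H n ltac:(lia)))).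
    intros h m _ [H1 H2] i Hi. destruct (Nat.eq_dec i n) as [->|]; [easy|]. apply H1; lia.
Qed.

Lemma jointly_step_size (Q : R -> nat -> Prop) (t : R) : 0 < t -> jointly Q ->
  exists N : nat, forall n m : nat, (N <= n)%nat -> (N <= m)%nat ->
    (0 < n)%nat /\ Q (t / INR n) m.
Proof.
  intros Ht [d [N [Hd H]]]. destruct (INR_unbounded (t / d)) as [N1 HN1].
  exists (Nat.max (Datatypes.S N1) N). intros n m Hn Hm.
  assert (Hn1 : (N1 <= n)%nat) by lia. apply le_INR in Hn1.
  assert (Hq : 0 < t / d) by now apply Rdiv_lt_0_compat.
  split; [lia|]. apply H; [|lia]. split; [apply Rdiv_lt_0_compat; lra|].
  apply (Rmult_lt_reg_r (INR n)); [lra|].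
  replace (t / INR n * INR n) with (t / d * d) by (field; lra).
  rewrite (Rmult_comm d). apply Rmult_lt_compat_r; lra.
Qed.

(** * Consistency of the approximating semigroups *)

Section Approximation.
Context {X : Banach} {A : Op X} (HAdd : densely_defined A)
  {Xm : nat -> Banach} {P : forall m, X -> Xm m} {J : forall m, Xm m -> X}
  (HP : forall m, is_linear (P m))
  (HPJ : forall m (y : Xm m), P m (J m y) = y)
  {MP : R} (HMP0 : 0 < MP) (HMP : forall m (x : X), vnorm (P m x) <= MP * vnorm x)
  {Am : forall m, Op (Xm m)} {Tm : forall m, R -> Xm m -> Xm m}
  (HAmgen : forall m, generates (Am m) (Tm m))
  {C : R} (HC : 1 <= C)
  (HTC : forall m h (y : Xm m), 0 <= h <= 1 -> vnorm (Tm m h y) <= C * vnorm y)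
  (HC1 : forall x, dom A x ->
     (forall m, dom (Am m) (P m x)) /\
     seq_lim (fun m => J m (app (Am m) (P m x))) (app A x)).

(** Since [P m (J m y) = y], the difference is the image under [P m] of the error in the consistency
    condition, and the [P m] are uniformly bounded. *)
Lemma approx_generator x eps : dom A x -> 0 < eps ->
  jointly (fun _ m => vnorm (app (Am m) (P m x) -v P m (app A x)) <= eps).
Proof.
  intros Hx Heps.
  apply (jointly_large (fun m => vnorm (app (Am m) (P m x) -v P m (app A x)) <= eps)).
  destruct (HC1 x Hx) as [_ Hlim].
  destruct (Hlim (eps / MP) ltac:(now apply Rdiv_lt_0_compat)) as [N HN].
  exists N. intros m Hm. specialize (HN m Hm).
  rewrite <- (HPJ m (app (Am m) (P m x))), <- (lin_sub (HP m)).
  eapply Rle_trans; [apply HMP|]. replace eps with (MP * (eps / MP)) by (field; lra).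
  apply Rmult_le_compat_l; lra.
Qed.

Lemma approx_mean_value x h (m : nat) (y : Xm m) e : dom A x -> 0 <= h ->
  (forall s, 0 <= s <= h -> vnorm (Tm m s (app (Am m) (P m x)) -v y) <= e) ->
  vnorm (Tm m h (P m x) -v P m x -v h *v y) <= e * h.
Proof.
  intros Hx Hh He. destruct (HAmgen m) as [Hsg Hgen].
  apply (sg_mean_value _ _ _ (app (Am m) (P m x))); try easy.
  apply Hgen. now apply HC1.
Qed.

(** Strong continuity of each [Tm m] gives nothing uniform in [m]. Uniformity holds on [dom A] by
    the mean value inequality, and extends to all [x] by density and the common bound [C]. *)
Lemma approx_continuous x eps : 0 < eps ->
  jointly (fun h m => forall s, 0 <= s <= h -> vnorm (Tm m s (P m x) -v P m x) <= eps).
Proof.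
  intros Heps. set (e := eps / (2 * ((C + 1) * MP))).
  assert (HCM : 0 < (C + 1) * MP) by (apply Rmult_lt_0_compat; lra).
  assert (He : 0 < e) by (apply Rdiv_lt_0_compat; lra).
  destruct (HAdd x e He) as [y [Hy Hxy]].
  (* Once [app (Am m) (P m y)] is within [1] of [P m (app A y)], this is a Lipschitz constant at
     time [0] for the orbit of [P m y], independent of [m]. *)
  set (K := C * (MP * vnorm (app A y) + 1)).
  assert (HK : 0 < K).
  { apply Rmult_lt_0_compat; [lra|]. pose proof (vnorm_nonneg _ (app A y)). nra. }
  assert (HKe : 0 < eps / (2 * K)) by (apply Rdiv_lt_0_compat; lra).
  apply (jointly_mono _ _ (jointly_and _ _ (approx_generator y 1 Hy Rlt_0_1)
    (jointly_and _ _ (jointly_small 1 Rlt_0_1) (jointly_small _ HKe)))).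
  intros h m Hh [Hgen [Hh1 Hh2]] s Hs.
  pose proof (sg_lin (proj1 (HAmgen m)) s ltac:(lra)) as Hlin.
  assert (H1 : vnorm (Tm m s (P m y) -v P m y) <= K * s).
  { replace (_ -v _) with (Tm m s (P m y) -v P m y -v s *v vzero) by vring.
    apply approx_mean_value; [easy|lra|]. intros r Hr.
    replace (_ -v vzero) with (Tm m r (app (Am m) (P m y))) by vring.
    eapply Rle_trans; [apply HTC; lra|]. apply Rmult_le_compat_l; [lra|].
    eapply Rle_trans; [apply (vnorm_le_add _ _ (P m (app A y)))|].
    specialize (HMP m (app A y)). lra. }
  assert (H2 : K * s <= eps / 2).
  { replace (eps / 2) with (K * (eps / (2 * K))) by (field; lra). apply Rmult_le_compat_l; lra. }
  assert (H3 : vnorm (P m (x -v y)) <= MP * e).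
  { eapply Rle_trans; [apply HMP|]. apply Rmult_le_compat_l; lra. }
  assert (H4 : vnorm (Tm m s (P m (x -v y))) <= C * (MP * e)).
  { eapply Rle_trans; [apply HTC; lra|]. apply Rmult_le_compat_l; lra. }
  replace (Tm m s (P m x) -v P m x) with
    (Tm m s (P m (x -v y)) -v P m (x -v y) +v (Tm m s (P m y) -v P m y)).
  - eapply Rle_trans; [apply vnorm_triangle|].
    eapply Rle_trans; [apply Rplus_le_compat_r, vnorm_sub_le|].
    assert (eps = 2 * ((C + 1) * MP * e)) by (unfold e; field; lra). lra.
  - rewrite (lin_sub (HP m)), (lin_sub Hlin). vring.
Qed.

(** The derivative of the orbit at time [s] is [Tm m s (app (Am m) (P m x))]. It is close to
    [P m (app A x)] by consistency of the generators and by [approx_continuous] at [app A x]. *)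
Lemma approx_deriv x eps : dom A x -> 0 < eps ->
  jointly (fun h m =>
    vnorm (Tm m h (P m x) -v P m x -v h *v P m (app A x)) <= eps * h).
Proof.
  intros Hx Heps.
  assert (He : 0 < eps / (2 * C)) by (apply Rdiv_lt_0_compat; lra).
  apply (jointly_mono _ _ (jointly_and _ _ (approx_generator x _ Hx He)
    (jointly_and _ _ (jointly_small 1 Rlt_0_1) (approx_continuous (app A x) (eps / 2) ltac:(lra))))).
  intros h m Hh [Hgen [Hh1 Hcont]]. apply approx_mean_value; [easy|lra|].
  intros s Hs. pose proof (sg_lin (proj1 (HAmgen m)) s ltac:(lra)) as Hlin.
  eapply Rle_trans; [apply (vnorm_dist_triangle _ (Tm m s (P m (app A x))))|].
  rewrite <- (lin_sub Hlin). specialize (Hcont s Hs).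
  pose proof (HTC m s (app (Am m) (P m x) -v P m (app A x)) ltac:(lra)).
  assert (C * (eps / (2 * C)) = eps / 2) by (field; lra). nra.
Qed.

End Approximation.
(** * A Chernoff product formula with spatial approximation *)

Lemma exp_monotone (x y : R) : x <= y -> exp x <= exp y.
Proof.
  intros [H| ->]; [apply Rlt_le, exp_increasing, H|apply Rle_refl].
Qed.

Lemma exp_le_affine (x : R) : 0 <= x <= / 2 -> exp x <= 1 + 2 * x.
Proof.
  intros Hx. pose proof (exp_ineq1_le (- x)) as H1. pose proof (exp_pos x) as H2.
  assert (H3 : exp x * exp (- x) = 1) by (rewrite <- exp_plus, Rplus_opp_r; apply exp_0).
  assert (H4 : exp x * (1 - x) <= 1) by nra. nra.
Qed.

Lemma exp_INR_mult (k : nat) (x : R) : exp (INR k * x) = exp x ^ k.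
Proof.
  induction k as [|k IH]; [simpl; now rewrite Rmult_0_l, exp_0|].
  rewrite S_INR, Rmult_plus_distr_r, Rmult_1_l, exp_plus, IH. simpl. ring.
Qed.

Lemma pow_div (r a : R) (k : nat) : (r / a) ^ k = r ^ k / a ^ k.
Proof. unfold Rdiv. now rewrite Rpow_mult_distr, pow_inv. Qed.

(** Stability turns local errors into a global one. The inner claim carries an extra power [i], so
    that induction on [j] telescopes without a sum being written down. *)
Lemma iter_telescope (Y : Banach) (f : Y -> Y) (C b : R) (n : nat) (a : nat -> Y) :
  is_linear f -> 0 <= C ->
  (forall k y, (k <= n)%nat -> vnorm (Nat.iter k f y) <= C * vnorm y) ->
  (forall j, (j < n)%nat -> vnorm (a (Datatypes.S j) -v f (a j)) <= b) ->
  vnorm (a n -v Nat.iter n f (a 0%nat)) <= INR n * (C * b).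
Proof.
  intros Hf HC Hk Ha.
  assert (H : forall j i, (i + j <= n)%nat ->
    vnorm (Nat.iter i f (a j) -v Nat.iter (i + j) f (a 0%nat)) <= INR j * (C * b)).
  { induction j as [|j IH]; intros i Hij.
    - rewrite Nat.add_0_r. replace (_ -v _) with (vzero : Y) by vring.
      rewrite vnorm_zero. simpl; lra.
    - rewrite S_INR. specialize (IH (Datatypes.S i) ltac:(lia)).
      replace (Datatypes.S i + j)%nat with (i + Datatypes.S j)%nat in IH by lia.
      eapply Rle_trans; [apply (vnorm_dist_triangle _ (Nat.iter (Datatypes.S i) f (a j)))|].
      assert (H1 : vnorm (Nat.iter i f (a (Datatypes.S j)) -v Nat.iter (Datatypes.S i) f (a j)) <= C * b).
      { simpl. rewrite <- iter_shift, <- (lin_sub (lin_iter _ _ i Hf)).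
        eapply Rle_trans; [apply Hk; lia|]. apply Rmult_le_compat_l; [easy|]. apply Ha; lia. }
      lra. }
  exact (H n 0%nat (le_n n)).
Qed.

(* Partial sum of the Neumann series of [h (a - f)^-1]. *)
Fixpoint neumann {Y : Banach} (f : Y -> Y) (h a : R) (K : nat) (v : Y) : Y :=
  match K with
  | O => vzero
  | Datatypes.S K => neumann f h a K v +v (h / a ^ Datatypes.S K) *v Nat.iter K f v
  end.

Section Neumann.
Context {Y : Banach} {f : Y -> Y} (Hf : is_linear f) (h a : R) (Ha : 0 < a).

Lemma neumann_lin K : is_linear (neumann f h a K).
Proof.
  induction K as [|K [IH1 IH2]]; split; intros; cbn [neumann].
  - vring.
  - vring.
  - rewrite IH1, (lin_add (lin_iter _ _ K Hf)). vring.
  - rewrite IH2, (lin_scal (lin_iter _ _ K Hf)). vring.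
Qed.

Lemma neumann_comm K v : neumann f h a K (f v) = f (neumann f h a K v).
Proof.
  induction K as [|K IH]; cbn [neumann].
  - now rewrite (lin_zero Hf).
  - now rewrite (lin_add Hf), (lin_scal Hf), IH, iter_shift.
Qed.

Lemma neumann_residual K v :
  a *v neumann f h a K v -v f (neumann f h a K v)
  = h *v v -v (h / a ^ K) *v Nat.iter K f v.
Proof.
  induction K as [|K IH]; cbn [neumann].
  - rewrite (lin_zero Hf). simpl. vring.
  - rewrite (lin_add Hf), (lin_scal Hf).
    replace (_ -v _) with ((a *v neumann f h a K v -v f (neumann f h a K v))
      +v (a * (h / a ^ Datatypes.S K)) *v Nat.iter K f v
      -v (h / a ^ Datatypes.S K) *v Nat.iter (Datatypes.S K) f v) by (simpl Nat.iter; vring).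
    rewrite IH. simpl pow. pose proof (pow_lt a K Ha).
    replace (a * (h / (a * a ^ K))) with (h / a ^ K) by (field; lra). vring.
Qed.

(** The geometric sum is [M * h / (a - r) * (1 - (r / a) ^ K)], and [h + r <= a] bounds the quotient
    [h / (a - r)] by [1]. *)
Lemma neumann_bound K v M r : 0 <= h -> 0 <= M -> 0 <= r -> h + r <= a ->
  (forall k, vnorm (Nat.iter k f v) <= M * r ^ k * vnorm v) ->
  vnorm (neumann f h a K v) <= M * (1 - (r / a) ^ K) * vnorm v.
Proof.
  intros Hh HM Hr Hsum Hk. pose proof (vnorm_nonneg _ v) as Hv.
  induction K as [|K IH]; cbn [neumann].
  - rewrite vnorm_zero. simpl. lra.
  - eapply Rle_trans; [apply vnorm_triangle|].
    pose proof (pow_lt a (Datatypes.S K) Ha) as Hp. pose proof (pow_lt a K Ha) as Hp'.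
    assert (Hc : 0 <= h / a ^ Datatypes.S K).
    { apply Rmult_le_pos; [easy|apply Rlt_le, Rinv_0_lt_compat, Hp]. }
    rewrite vnorm_scal_pos by easy.
    eapply Rle_trans; [apply Rplus_le_compat; [apply IH|apply Rmult_le_compat_l; [easy|apply Hk]]|].
    set (q := (r / a) ^ K).
    assert (Hq : 0 <= q) by (apply pow_le, Rmult_le_pos; [easy|apply Rlt_le, Rinv_0_lt_compat, Ha]).
    replace (h / a ^ Datatypes.S K * (M * r ^ K * vnorm v)) with (M * vnorm v * q * (h / a)).
    2:{ unfold q. rewrite pow_div. simpl. field. lra. }
    replace ((r / a) ^ Datatypes.S K) with (q * (r / a)) by (unfold q; simpl; ring).
    assert (Hle : h / a <= 1 - r / a).
    { apply (Rmult_le_reg_r a); [easy|]. replace (h / a * a) with h by (field; lra).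
      replace ((1 - r / a) * a) with (a - r) by (field; lra). lra. }
    assert (0 <= M * vnorm v * q) by (apply Rmult_le_pos; [apply Rmult_le_pos|]; easy).
    apply Rle_trans with (M * (1 - q) * vnorm v + M * vnorm v * q * (1 - r / a)).
    + apply Rplus_le_compat_l, Rmult_le_compat_l; easy.
    + apply Req_le. ring.
Qed.

End Neumann.

(** * Approximate resolvents and convergence of powers *)

Section Chernoff.
Context {X : Banach} {U : R -> X -> X} (HU : is_C0_semigroup U)
  {Xm : nat -> Banach} {P : forall m, X -> Xm m} (HP : forall m, is_linear (P m))
  {MP : R} (HMP0 : 0 < MP) (HMP : forall m (x : X), vnorm (P m x) <= MP * vnorm x)
  {F : forall m, R -> Xm m -> Xm m}
  (HF : forall m h, 0 < h -> is_linear (F m h))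
  {M w : R} (HM : 1 <= M) (Hw : 0 <= w)
  (Hstab : forall m h k (y : Xm m), 0 < h <= 1 ->
     vnorm (Nat.iter k (F m h) y) <= M * exp (INR k * (w * h)) * vnorm y)
  {D : X -> X -> Prop}
  (Hcore : forall x c, orbit_deriv U x c -> forall eps, 0 < eps ->
     exists x' c', D x' c' /\ vnorm (x -v x') <= eps /\ vnorm (c -v c') <= eps)
  (Hcons : forall x c, D x c -> forall eps, 0 < eps ->
     jointly (fun h m => vnorm (F m h (P m x) -v P m x -v h *v P m c) <= eps * h)).

(** As [exp (w * h) <= 1 + 2 * (w * h)] for [w * h <= / 2], this value gives
    [h + exp (w * h) <= 1 + lam * h], the condition under which the Neumann sum is bounded by [M]
    for every step size. *)
Let lam := 2 * w + 1.

(* [G] is, up to a relative error [h], the resolvent at [lam] of the difference quotient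
   [(F m h - 1) / h]. The resolvent of the generator of [U] is never needed. *)
Definition approx_resolvent (m : nat) (h : R) (G : Xm m -> Xm m) : Prop :=
  is_linear G /\ (forall v, vnorm (G v) <= M * vnorm v) /\
  (forall v, vnorm ((1 + lam * h) *v G v -v F m h (G v) -v h *v v) <= h * h * vnorm v) /\
  (forall v, G (F m h v) = F m h (G v)).

Lemma approx_resolvent_exists :
  jointly (fun h m => exists G, approx_resolvent m h G).
Proof.
  (* Below this threshold both [h <= 1] and [w * h <= / 2] hold. *)
  assert (Hd : 0 < / (2 * w + 2)) by (apply Rinv_0_lt_compat; lra).
  apply (jointly_mono _ _ (jointly_small _ Hd)). intros h m Hh Hhd.
  assert (Hh2 : h * (2 * w + 2) < 1).
  { rewrite <- (Rinv_l (2 * w + 2)) by lra. apply Rmult_lt_compat_r; lra. }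
  assert (Hh1 : 0 < h <= 1) by nra.
  assert (Hwh : 0 <= w * h <= / 2) by nra.
  set (a := 1 + lam * h). set (r := exp (w * h)).
  assert (Ha : 0 < a) by (unfold a, lam; nra).
  assert (Hr : 0 < r) by apply exp_pos.
  assert (Hhra : h + r <= a).
  { pose proof (exp_le_affine _ Hwh). unfold r, a, lam. nra. }
  assert (Hq : 0 <= r / a < 1).
  { split; [apply Rmult_le_pos; [lra|apply Rlt_le, Rinv_0_lt_compat, Ha]|].
    apply (Rmult_lt_reg_r a); [easy|]. replace (r / a * a) with r by (field; lra). lra. }
  (* The truncation order [K] depends on [h]: the tail of the series, at most [h * M * (r / a) ^ K],
     has to fall below [h * h]. *)
  destruct (pow_lt_1_zero (r / a) ltac:(rewrite Rabs_pos_eq; lra) (h / M)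
    ltac:(apply Rdiv_lt_0_compat; lra)) as [K HK].
  specialize (HK K (le_n K)). rewrite Rabs_pos_eq in HK by (apply pow_le; lra).
  assert (Hiter : forall k (v : Xm m), vnorm (Nat.iter k (F m h) v) <= M * r ^ k * vnorm v).
  { intros k v. unfold r. rewrite <- exp_INR_mult. now apply Hstab. }
  exists (neumann (F m h) h a K). pose proof (HF m h Hh) as Hf.
  split; [|split; [|split]].
  - now apply neumann_lin.
  - intros v. eapply Rle_trans; [apply (neumann_bound h a Ha K v M r); try lra; intros k; apply Hiter|].
    apply Rmult_le_compat_r; [apply vnorm_nonneg|].
    assert (0 <= (r / a) ^ K) by (apply pow_le; lra). nra.
  - intros v. rewrite (neumann_residual Hf h a Ha).
    replace (_ -v _) with (vopp ((h / a ^ K) *v Nat.iter K (F m h) v)) by vring.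
    pose proof (pow_lt a K Ha) as Hp. rewrite vnorm_opp.
    assert (Hc : 0 <= h / a ^ K).
    { apply Rmult_le_pos; [lra|apply Rlt_le, Rinv_0_lt_compat, Hp]. }
    rewrite vnorm_scal_pos by easy.
    eapply Rle_trans; [apply Rmult_le_compat_l; [easy|apply Hiter]|].
    replace (h / a ^ K * (M * r ^ K * vnorm v)) with (h * (M * (r / a) ^ K) * vnorm v).
    + apply Rmult_le_compat_r; [apply vnorm_nonneg|]. apply Rmult_le_compat_l; [lra|].
      replace h with (M * (h / M)) at 1 by (field; lra). apply Rmult_le_compat_l; lra.
    + rewrite pow_div. field. lra.
  - intros v. now apply neumann_comm.
Qed.

Lemma resolvent_consistent x c eps : orbit_deriv U x c -> 0 < eps ->
  jointly (fun h m => forall G, approx_resolvent m h G ->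
    vnorm (G (P m (lam *v x -v c)) -v P m x) <= eps).
Proof.
  intros Hxc Heps. assert (Hlam : 0 < lam) by (unfold lam; lra).
  set (K := M * (MP * (lam + 1)) + MP).
  assert (HK : 0 < K).
  { unfold K. assert (0 < MP * (lam + 1)) by (apply Rmult_lt_0_compat; lra). nra. }
  destruct (Hcore x c Hxc (eps / (2 * K)) ltac:(apply Rdiv_lt_0_compat; lra)) as [y [b [Hyb [Hxy Hcb]]]].
  set (e := eps / (2 * K)) in *.
  pose proof (vnorm_nonneg _ y) as Hy0.
  assert (HMy : 0 < MP * vnorm y + 1) by nra.
  assert (He1 : 0 < eps / (4 * M)) by (apply Rdiv_lt_0_compat; lra).
  assert (He2 : 0 < eps / (4 * (MP * vnorm y + 1))) by (apply Rdiv_lt_0_compat; lra).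
  apply (jointly_mono _ _ (jointly_and _ _ (Hcons y b Hyb _ He1) (jointly_small _ He2))).
  intros h m Hh [Hc Hhs] G [HG [HGM [HGres HGF]]].
  set (Py := P m y) in *. set (rho := F m h Py -v Py -v h *v P m b) in *.
  set (res := (1 + lam * h) *v G Py -v F m h (G Py) -v h *v Py).
  (* Apply [G] to [(1 + lam h) P y - F P y = h (lam P y - P b) - rho]. *)
  assert (Hid : G (P m (lam *v x -v c)) -v P m x =
    G (P m (lam *v (x -v y) -v (c -v b))) -v P m (x -v y) +v / h *v (res +v G rho)).
  { unfold res, rho. rewrite <- HGF.
    rewrite !(lin_sub (HP m)), !(lin_scal (HP m)), !(lin_sub (HP m)). fold Py.
    repeat rewrite ?(lin_sub HG), ?(lin_scal HG). vring. }
  rewrite Hid. eapply Rle_trans; [apply vnorm_triangle|].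
  eapply Rle_trans; [apply Rplus_le_compat_r, vnorm_sub_le|].
  assert (H1 : vnorm (P m (lam *v (x -v y) -v (c -v b))) <= MP * (lam + 1) * e).
  { eapply Rle_trans; [apply HMP|]. rewrite Rmult_assoc. apply Rmult_le_compat_l; [lra|].
    eapply Rle_trans; [apply vnorm_sub_le|]. rewrite vnorm_scal_pos by lra. nra. }
  assert (H2 : vnorm (G (P m (lam *v (x -v y) -v (c -v b)))) <= M * (MP * (lam + 1) * e)).
  { eapply Rle_trans; [apply HGM|]. apply Rmult_le_compat_l; lra. }
  assert (H3 : vnorm (P m (x -v y)) <= MP * e).
  { eapply Rle_trans; [apply HMP|]. apply Rmult_le_compat_l; lra. }
  (* Division by [h] is harmless here, as [res] is of order [h * h] and [rho] is small compared with
     [h]. *)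
  assert (H4 : vnorm (/ h *v (res +v G rho)) <= eps / 2).
  { rewrite vnorm_scal_pos by (apply Rlt_le, Rinv_0_lt_compat, Hh).
    replace (eps / 2) with (/ h * (h * (eps / 4) + h * (eps / 4))) by (field; lra).
    apply Rmult_le_compat_l; [apply Rlt_le, Rinv_0_lt_compat, Hh|].
    eapply Rle_trans; [apply vnorm_triangle|]. apply Rplus_le_compat.
    - eapply Rle_trans; [apply HGres|]. rewrite Rmult_assoc. apply Rmult_le_compat_l; [lra|].
      pose proof (HMP m y) as HPy. fold Py in HPy.
      replace (eps / 4) with (eps / (4 * (MP * vnorm y + 1)) * (MP * vnorm y + 1)) by (field; lra).
      pose proof (vnorm_nonneg _ Py). apply Rmult_le_compat; lra.
    - eapply Rle_trans; [apply HGM|].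
      replace (h * (eps / 4)) with (M * (eps / (4 * M) * h)) by (field; lra).
      apply Rmult_le_compat_l; lra. }
  assert (HKe : K * e = eps / 2) by (unfold e; field; lra). unfold K in HKe. lra.
Qed.

(* Uniformity in [s] comes from a finite grid, since the orbits of [x] and [c] are
   uniformly continuous and [G], [P m] are uniformly bounded. *)
Lemma resolvent_consistent_orbit x c t eps : orbit_deriv U x c -> 0 < t -> 0 < eps ->
  jointly (fun h m => forall G, approx_resolvent m h G -> forall s, 0 <= s <= t ->
    vnorm (G (P m (lam *v U s x -v U s c)) -v P m (U s x)) <= eps).
Proof.
  intros Hxc Ht Heps. assert (Hlam : 0 < lam) by (unfold lam; lra).
  destruct (sg_locally_bounded HU t) as [C [HC HUC]].
  set (K := M * (MP * (lam + 1)) + MP).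
  assert (HK : 0 < K).
  { unfold K. assert (0 < MP * (lam + 1)) by (apply Rmult_lt_0_compat; lra). nra. }
  set (e := eps / (2 * K)). assert (He : 0 < e) by (apply Rdiv_lt_0_compat; lra).
  destruct (sg_right_continuous HU x (e / C) ltac:(apply Rdiv_lt_0_compat; lra)) as [d1 [Hd1 H1]].
  destruct (sg_right_continuous HU c (e / C) ltac:(apply Rdiv_lt_0_compat; lra)) as [d2 [Hd2 H2]].
  set (d := Rmin d1 d2). assert (Hd : 0 < d) by now apply Rmin_glb_lt.
  assert (Hdd : d <= d1 /\ d <= d2) by (split; [apply Rmin_l|apply Rmin_r]).
  destruct (nat_floor t d ltac:(lra) Hd) as [n Hn].
  assert (Hgrid : jointly (fun h m => forall i, (i < Datatypes.S n)%nat ->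
    forall G, approx_resolvent m h G ->
    vnorm (G (P m (lam *v U (INR i * d) x -v U (INR i * d) c)) -v P m (U (INR i * d) x)) <= eps / 2)).
  { apply (jointly_finite (fun i h m => forall G, approx_resolvent m h G ->
    vnorm (G (P m (lam *v U (INR i * d) x -v U (INR i * d) c)) -v P m (U (INR i * d) x)) <= eps / 2)).
    intros i _. apply resolvent_consistent; [|lra]. apply orbit_deriv_orbit; [easy| |easy].
    apply Rmult_le_pos; [apply pos_INR|lra]. }
  apply (jointly_mono _ _ Hgrid). intros h m Hh Hg G HG s Hs.
  destruct (nat_floor s d ltac:(lra) Hd) as [i Hi].
  assert (Hin : (i < Datatypes.S n)%nat).
  { apply INR_lt. rewrite S_INR. apply (Rmult_lt_reg_r d); [easy|lra]. }
  specialize (Hg i Hin G HG). destruct HG as [HG [HGM _]].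
  set (s0 := INR i * d) in *.
  assert (Hs0 : 0 <= s0) by (apply Rmult_le_pos; [apply pos_INR|lra]).
  assert (Hclose : forall z, (forall r, 0 <= r < d -> vnorm (U r z -v z) < e / C) ->
            vnorm (U s z -v U s0 z) <= e).
  { intros z Hz. rewrite (sg_sub HU) by lra. eapply Rle_trans; [apply HUC; lra|].
    replace e with (C * (e / C)) by (field; lra). apply Rmult_le_compat_l; [lra|].
    apply Rlt_le, Hz. unfold s0 in *. lra. }
  assert (Hx := Hclose x ltac:(intros; apply H1; lra)).
  assert (Hc := Hclose c ltac:(intros; apply H2; lra)).
  replace (_ -v _) with
    (G (P m (lam *v (U s x -v U s0 x) -v (U s c -v U s0 c))) -v P m (U s x -v U s0 x)
     +v (G (P m (lam *v U s0 x -v U s0 c)) -v P m (U s0 x))).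
  2:{ rewrite !(lin_sub (HP m)), !(lin_scal (HP m)), !(lin_sub (HP m)).
      repeat rewrite ?(lin_sub HG), ?(lin_scal HG). vring. }
  eapply Rle_trans; [apply vnorm_triangle|].
  eapply Rle_trans; [apply Rplus_le_compat_r, vnorm_sub_le|].
  assert (H3 : vnorm (P m (lam *v (U s x -v U s0 x) -v (U s c -v U s0 c))) <= MP * (lam + 1) * e).
  { eapply Rle_trans; [apply HMP|]. rewrite Rmult_assoc. apply Rmult_le_compat_l; [lra|].
    eapply Rle_trans; [apply vnorm_sub_le|]. rewrite vnorm_scal_pos by lra. nra. }
  assert (H4 : vnorm (G (P m (lam *v (U s x -v U s0 x) -v (U s c -v U s0 c)))) <= M * (MP * (lam + 1) * e)).
  { eapply Rle_trans; [apply HGM|]. apply Rmult_le_compat_l; lra. }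
  assert (H5 : vnorm (P m (U s x -v U s0 x)) <= MP * e).
  { eapply Rle_trans; [apply HMP|]. apply Rmult_le_compat_l; lra. }
  assert (HKe : K * e = eps / 2) by (unfold e; field; lra). unfold K in HKe. lra.
Qed.

Lemma iter_bound (t : R) : exists C, 1 <= C /\
  forall m h k n (y : Xm m), 0 < h <= 1 -> INR n * h = t -> (k <= n)%nat ->
    vnorm (Nat.iter k (F m h) y) <= C * vnorm y.
Proof.
  exists (M * exp (Rabs (w * t))). split.
  { pose proof (exp_ineq1_le (Rabs (w * t))). pose proof (Rabs_pos (w * t)).
    assert (1 <= exp (Rabs (w * t))) by lra. nra. }
  intros m h k n y Hh Hn Hk. eapply Rle_trans; [now apply Hstab|].
  apply Rmult_le_compat_r; [apply vnorm_nonneg|]. apply Rmult_le_compat_l; [lra|].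
  apply exp_monotone. eapply Rle_trans; [|apply Rle_abs]. subst t.
  apply le_INR in Hk. replace (w * (INR n * h)) with (INR n * (w * h)) by ring.
  apply Rmult_le_compat_r; [apply Rmult_le_pos; lra|easy].
Qed.

Lemma smoothed_convergence_dom x c t eps : orbit_deriv U x c -> 0 < t -> 0 < eps ->
  jointly (fun h m => forall G n, approx_resolvent m h G -> INR n * h = t ->
    vnorm (Nat.iter n (F m h) (G (P m x)) -v G (P m (U t x))) <= eps).
Proof.
  intros Hxc Ht Heps.
  destruct (sg_locally_bounded HU t) as [C [HC HUC]].
  destruct (iter_bound t) as [C' [HC' Hiter]].
  (* Each step makes three errors of size [h * e], powers amplify them by [C'], and [n] steps of
     length [h] add up to [t]. *)
  set (e := eps / (3 * (C' * t))).
  assert (HCt : 0 < C' * t) by (apply Rmult_lt_0_compat; lra).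
  assert (He : 0 < e) by (apply Rdiv_lt_0_compat; lra).
  assert (HMMC : 0 < M * MP * C) by (apply Rmult_lt_0_compat; [apply Rmult_lt_0_compat|]; lra).
  destruct (orbit_deriv_expansion HU x c (e / (M * MP * C)) Hxc
    ltac:(now apply Rdiv_lt_0_compat)) as [d [Hd Hexp]].
  pose proof (vnorm_nonneg _ x) as Hx0.
  assert (HCx : 0 < MP * (C * vnorm x) + 1).
  { assert (0 <= MP * (C * vnorm x)) by (apply Rmult_le_pos; [|apply Rmult_le_pos]; lra). lra. }
  assert (Hd' : 0 < e / (MP * (C * vnorm x) + 1)) by now apply Rdiv_lt_0_compat.
  apply (jointly_mono _ _ (jointly_and _ _ (resolvent_consistent_orbit x c t e Hxc Ht He)
    (jointly_and _ _ (jointly_small d Hd) (jointly_and _ _ (jointly_small 1 Rlt_0_1) (jointly_small _ Hd'))))).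
  intros h m Hh [Hres [Hhd [Hh1 Hhe]]] G n HG Hnh.
  specialize (Hres G HG). destruct HG as [HG [HGM [HGres HGF]]].
  rewrite vnorm_sub_sym.
  set (a := fun j => G (P m (U (INR j * h) x))).
  replace (G (P m (U t x))) with (a n) by (unfold a; now rewrite Hnh).
  replace (G (P m x)) with (a 0%nat) by (unfold a; simpl; now rewrite Rmult_0_l, (sg_zero HU)).
  replace eps with (INR n * (C' * (3 * e * h))).
  2:{ replace (INR n * (C' * (3 * e * h))) with (3 * (C' * (INR n * h)) * e) by ring.
      rewrite Hnh. unfold e. field. lra. }
  apply iter_telescope; [now apply HF|lra|intros k y Hk; apply (Hiter m h k n); [lra|easy|easy]|].
  intros j Hj. unfold a. rewrite S_INR.
  apply lt_INR in Hj. pose proof (pos_INR j) as Hj0.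
  assert (Hs : 0 <= INR j * h <= t).
  { split; [apply Rmult_le_pos; lra|]. rewrite <- Hnh. apply Rmult_le_compat_r; lra. }
  replace ((INR j + 1) * h) with (INR j * h + h) by ring. rewrite (sg_add HU) by lra.
  set (s := INR j * h) in *. specialize (Hres s Hs).
  set (q := U s x) in *.
  set (res := (1 + lam * h) *v G (P m q) -v F m h (G (P m q)) -v h *v P m q).
  set (rho := U h x -v x -v h *v c) in *.
  (* The resolvent relation expresses [G (P m q) -v F m h (G (P m q))] through [res] and [h] times
     bounded terms. What remains is the resolvent consistency at [q], so no expansion of [F m h] at
     [q] is required. *)
  assert (Hid : G (P m (U s (U h x))) -v F m h (G (P m q)) =
    res +v G (P m (U s rho)) -v h *v (G (P m (lam *v q -v U s c)) -v P m q)).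
  { unfold res, rho. pose proof (sg_lin HU s (proj1 Hs)) as HUs.
    rewrite !(lin_sub HUs), (lin_scal HUs). fold q.
    rewrite !(lin_sub (HP m)), !(lin_scal (HP m)).
    repeat rewrite ?(lin_sub HG), ?(lin_scal HG). vring. }
  rewrite Hid. eapply Rle_trans; [apply vnorm_sub_le|].
  eapply Rle_trans; [apply Rplus_le_compat_r, vnorm_triangle|].
  rewrite vnorm_scal_pos by lra.
  assert (H1 : vnorm res <= h * e).
  { eapply Rle_trans; [apply HGres|]. rewrite Rmult_assoc. apply Rmult_le_compat_l; [lra|].
    assert (HPq : vnorm (P m q) <= MP * (C * vnorm x)).
    { eapply Rle_trans; [apply HMP|]. apply Rmult_le_compat_l; [lra|]. now apply HUC. }
    replace e with (e / (MP * (C * vnorm x) + 1) * (MP * (C * vnorm x) + 1)) by (field; lra).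
    pose proof (vnorm_nonneg _ (P m q)). apply Rmult_le_compat; lra. }
  assert (H2 : vnorm (G (P m (U s rho))) <= h * e).
  { eapply Rle_trans; [apply HGM|].
    specialize (Hexp h ltac:(lra)). fold rho in Hexp.
    replace (h * e) with (M * (MP * (C * (e / (M * MP * C) * h)))) by (field; lra).
    apply Rmult_le_compat_l; [lra|]. eapply Rle_trans; [apply HMP|].
    apply Rmult_le_compat_l; [lra|]. eapply Rle_trans; [now apply HUC|].
    apply Rmult_le_compat_l; lra. }
  assert (H3 : h * vnorm (G (P m (lam *v q -v U s c)) -v P m q) <= h * e).
  { apply Rmult_le_compat_l; lra. }
  lra.
Qed.

(** The extension beyond the domain of the generator matters because the lemma is applied at
    [lam *v y -v c], which need not belong to it. *)
Lemma smoothed_convergence x t eps : 0 < t -> 0 < eps ->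
  jointly (fun h m => forall G n, approx_resolvent m h G -> INR n * h = t ->
    vnorm (Nat.iter n (F m h) (G (P m x)) -v G (P m (U t x))) <= eps).
Proof.
  intros Ht Heps.
  destruct (sg_locally_bounded HU t) as [C [HC HUC]].
  destruct (iter_bound t) as [C' [HC' Hiter]].
  set (K := C' * (M * MP) + M * (MP * C)).
  assert (HMMP : 0 < M * MP) by (apply Rmult_lt_0_compat; lra).
  assert (HK : 0 < K) by (unfold K; nra).
  destruct (generator_dense HU x (eps / (2 * K)) ltac:(apply Rdiv_lt_0_compat; lra)) as [y [c [Hyc Hyx]]].
  set (e := eps / (2 * K)) in *. rewrite vnorm_sub_sym in Hyx.
  apply (jointly_mono _ _ (jointly_and _ _ (smoothed_convergence_dom y c t (eps / 2) Hyc Ht ltac:(lra))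
    (jointly_small 1 Rlt_0_1))).
  intros h m Hh [H Hh1] G n HGr Hnh. specialize (H G n HGr Hnh).
  destruct HGr as [HG [HGM _]].
  pose proof (lin_iter _ _ n (HF m h Hh)) as HFn. pose proof (sg_lin HU t ltac:(lra)) as HUt.
  replace (_ -v _) with (Nat.iter n (F m h) (G (P m (x -v y))) -v G (P m (U t (x -v y)))
    +v (Nat.iter n (F m h) (G (P m y)) -v G (P m (U t y)))).
  2:{ rewrite (lin_sub HUt), !(lin_sub (HP m)), !(lin_sub HG), (lin_sub HFn). vring. }
  eapply Rle_trans; [apply vnorm_triangle|].
  eapply Rle_trans; [apply Rplus_le_compat_r, vnorm_sub_le|].
  assert (H1 : vnorm (Nat.iter n (F m h) (G (P m (x -v y)))) <= C' * (M * (MP * e))).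
  { eapply Rle_trans; [apply (Hiter m h n n); [lra|easy|easy]|]. apply Rmult_le_compat_l; [lra|].
    eapply Rle_trans; [apply HGM|]. apply Rmult_le_compat_l; [lra|].
    eapply Rle_trans; [apply HMP|]. apply Rmult_le_compat_l; lra. }
  assert (H2 : vnorm (G (P m (U t (x -v y)))) <= M * (MP * (C * e))).
  { eapply Rle_trans; [apply HGM|]. apply Rmult_le_compat_l; [lra|].
    eapply Rle_trans; [apply HMP|]. apply Rmult_le_compat_l; [lra|].
    eapply Rle_trans; [apply HUC; lra|]. apply Rmult_le_compat_l; lra. }
  assert (HKe : K * e = eps / 2) by (unfold e; field; lra). unfold K in HKe. lra.
Qed.

Theorem chernoff_product_formula x t eps : 0 < t -> 0 < eps ->
  jointly (fun h m => forall n, INR n * h = t ->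
    vnorm (Nat.iter n (F m h) (P m x) -v P m (U t x)) <= eps).
Proof.
  intros Ht Heps.
  destruct (sg_locally_bounded HU t) as [C [HC HUC]].
  destruct (iter_bound t) as [C' [HC' Hiter]].
  set (K := C' * MP + MP * C).
  assert (HK : 0 < K) by (unfold K; nra).
  destruct (generator_dense HU x (eps / (4 * K)) ltac:(apply Rdiv_lt_0_compat; lra)) as [y [c [Hyc Hyx]]].
  set (e := eps / (4 * K)) in *. rewrite vnorm_sub_sym in Hyx.
  assert (He' : 0 < eps / (4 * C')) by (apply Rdiv_lt_0_compat; lra).
  assert (Htt : 0 <= t) by lra.
  apply (jointly_mono _ _ (jointly_and _ _ approx_resolvent_exists (jointly_and _ _
    (smoothed_convergence (lam *v y -v c) t (eps / 4) Ht ltac:(lra)) (jointly_and _ _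
    (resolvent_consistent y c _ Hyc He') (jointly_and _ _
    (resolvent_consistent _ _ (eps / 4) (orbit_deriv_orbit HU t y c Htt Hyc) ltac:(lra))
    (jointly_small 1 Rlt_0_1)))))).
  intros h m Hh [[G HGr] [Hs [H0 [Ht0 Hh1]]]] n Hnh.
  specialize (Hs G n HGr Hnh). specialize (H0 G HGr). specialize (Ht0 G HGr).
  pose proof (lin_iter _ _ n (HF m h Hh)) as HFn. pose proof (sg_lin HU t Htt) as HUt.
  set (z := lam *v y -v c) in *.
  replace (lam *v U t y -v U t c) with (U t z) in Ht0
    by (unfold z; rewrite (lin_sub HUt), (lin_scal HUt); vring).
  (* Beyond the passage from [x] to [y], [P m y] is exchanged for [G (P m z)] at time [0], and
     [P m (U t y)] for [G (P m (U t z))] at time [t]. The latter is resolvent consistency at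
     [U t y], since [U t z] is [lam *v U t y -v U t c]. *)
  replace (_ -v _) with
    (Nat.iter n (F m h) (P m (x -v y)) -v P m (U t (x -v y))
     -v Nat.iter n (F m h) (G (P m z) -v P m y)
     +v (Nat.iter n (F m h) (G (P m z)) -v G (P m (U t z)))
     +v (G (P m (U t z)) -v P m (U t y))).
  2:{ rewrite (lin_sub HUt), !(lin_sub (HP m)), !(lin_sub HFn). vring. }
  eapply Rle_trans; [apply vnorm_triangle|].
  eapply Rle_trans; [apply Rplus_le_compat_r, vnorm_triangle|].
  eapply Rle_trans; [apply Rplus_le_compat_r, Rplus_le_compat_r, vnorm_sub_le|].
  eapply Rle_trans; [apply Rplus_le_compat_r, Rplus_le_compat_r, Rplus_le_compat_r, vnorm_sub_le|].
  assert (H1 : vnorm (Nat.iter n (F m h) (P m (x -v y))) <= C' * (MP * e)).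
  { eapply Rle_trans; [apply (Hiter m h n n); [lra|easy|easy]|]. apply Rmult_le_compat_l; [lra|].
    eapply Rle_trans; [apply HMP|]. apply Rmult_le_compat_l; lra. }
  assert (H2 : vnorm (P m (U t (x -v y))) <= MP * (C * e)).
  { eapply Rle_trans; [apply HMP|]. apply Rmult_le_compat_l; [lra|].
    eapply Rle_trans; [apply HUC; lra|]. apply Rmult_le_compat_l; lra. }
  assert (H3 : vnorm (Nat.iter n (F m h) (G (P m z) -v P m y)) <= eps / 4).
  { eapply Rle_trans; [apply (Hiter m h n n); [lra|easy|easy]|].
    replace (eps / 4) with (C' * (eps / (4 * C'))) by (field; lra). apply Rmult_le_compat_l; lra. }
  assert (HKe : K * e = eps / 4) by (unfold e; field; lra). unfold K in HKe. lra.
Qed.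

End Chernoff.
(** * The Strang splitting *)

Definition strang {Y : Banach} (T S : R -> Y -> Y) (h : R) (z : Y) : Y :=
  T (h / 2) (S h (T (h / 2) z)).

Lemma growth_bound_unit (Y : Banach) (T : R -> Y -> Y) (M w : R) :
  is_C0_semigroup T -> 1 <= M ->
  (forall h, 0 < h -> forall y, vnorm (T h y) <= M * exp (w * h) * vnorm y) ->
  forall h y, 0 <= h <= 1 -> vnorm (T h y) <= M * exp (Rabs w) * vnorm y.
Proof.
  intros HT HM Hb h y Hh. pose proof (vnorm_nonneg _ y) as Hy.
  destruct (Req_dec h 0) as [->|Hne].
  - rewrite (sg_zero HT). pose proof (exp_ineq1_le (Rabs w)). pose proof (Rabs_pos w).
    assert (1 <= exp (Rabs w)) by lra. assert (1 <= M * exp (Rabs w)) by nra. nra.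
  - eapply Rle_trans; [apply Hb; lra|]. apply Rmult_le_compat_r; [easy|].
    apply Rmult_le_compat_l; [lra|]. apply exp_monotone.
    pose proof (Rle_abs w). pose proof (Rabs_pos w). nra.
Qed.

Lemma strang_iter (Y : Banach) (T S : R -> Y -> Y) (h : R) (k : nat) (z : Y) :
  is_C0_semigroup T -> 0 <= h ->
  Nat.iter (Datatypes.S k) (strang T S h) z
  = T (h / 2) (Nat.iter k (fun z => S h (T h z)) (S h (T (h / 2) z))).
Proof.
  intros HT Hh. induction k as [|k IH]; [easy|].
  change (Nat.iter (Datatypes.S (Datatypes.S k)) (strang T S h) z)
    with (strang T S h (Nat.iter (Datatypes.S k) (strang T S h) z)).
  rewrite IH. unfold strang at 1. rewrite <- (sg_add HT) by lra.
  now replace (h / 2 + h / 2) with h by field.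
Qed.

(** The factor [C ^ 3] pays for the three flows left outside the sequential power in [strang_iter].
    That power is one lower than [k], and [Rabs w] makes the exponential monotone in it. *)
Lemma strang_stable (Y : Banach) (T S : R -> Y -> Y) (C M w h : R) (k : nat) (y : Y) :
  is_C0_semigroup T -> 1 <= C -> 1 <= M ->
  (forall s z, 0 <= s <= 1 -> vnorm (T s z) <= C * vnorm z) ->
  (forall s z, 0 <= s <= 1 -> vnorm (S s z) <= C * vnorm z) ->
  (forall j z, vnorm (Nat.iter j (fun z => S h (T h z)) z) <= M * exp (INR j * (w * h)) * vnorm z) ->
  0 < h <= 1 ->
  vnorm (Nat.iter k (strang T S h) y) <= C ^ 3 * M * exp (INR k * (Rabs w * h)) * vnorm y.
Proof.
  intros HT HC HM HTC HSC Hst Hh. pose proof (vnorm_nonneg _ y) as Hy.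
  assert (HC3 : 1 <= C ^ 3) by now apply pow_R1_Rle.
  destruct k as [|k].
  - simpl INR. rewrite Rmult_0_l, exp_0. cbn [Nat.iter nat_rect].
    assert (1 <= C ^ 3 * M) by nra. nra.
  - rewrite strang_iter by (easy || lra).
    assert (H1 := HTC (h / 2) y ltac:(lra)).
    assert (H2 := HSC h (T (h / 2) y) ltac:(lra)).
    set (v := S h (T (h / 2) y)) in *.
    assert (Hv : vnorm v <= C * (C * vnorm y)).
    { eapply Rle_trans; [apply H2|]. apply Rmult_le_compat_l; lra. }
    eapply Rle_trans; [apply HTC; lra|].
    set (E := exp (INR (Datatypes.S k) * (Rabs w * h))).
    assert (HE : exp (INR k * (w * h)) <= E).
    { apply exp_monotone. rewrite S_INR. pose proof (pos_INR k).
      assert (w * h <= Rabs w * h) by (apply Rmult_le_compat_r; [lra|apply Rle_abs]).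
      assert (0 <= Rabs w * h) by (apply Rmult_le_pos; [apply Rabs_pos|lra]). nra. }
    replace (C ^ 3 * M * E * vnorm y) with (C * (M * E * (C * (C * vnorm y)))) by ring.
    apply Rmult_le_compat_l; [lra|]. eapply Rle_trans; [apply Hst|].
    pose proof (exp_pos (INR k * (w * h))).
    apply Rmult_le_compat; [nra|apply vnorm_nonneg| |easy].
    apply Rmult_le_compat_l; lra.
Qed.

(** The flows are expanded in turn. One half step contributes [(h / 2) *v a] as it stands, the other
    contributes it moved by both flows, and that deviation splits into [T (S a - a)] and [T a - a].
    For [a] and [b], which need not lie in any domain, only continuity of the flows is used, so the
    remainder is small compared with [h] but not of order [h * h]. *)
Lemma strang_expansion (Y : Banach) (T S : R -> Y -> Y) (C h e : R) (p a b : Y) :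
  is_C0_semigroup T -> is_C0_semigroup S -> 1 <= C -> 0 < h <= 1 -> 0 <= e ->
  (forall s z, 0 <= s <= 1 -> vnorm (T s z) <= C * vnorm z) ->
  (forall s z, 0 <= s <= 1 -> vnorm (S s z) <= C * vnorm z) ->
  vnorm (T (h / 2) p -v p -v (h / 2) *v a) <= e * (h / 2) ->
  vnorm (S h p -v p -v h *v b) <= e * h ->
  vnorm (T (h / 2) a -v a) <= e -> vnorm (S h a -v a) <= e -> vnorm (T (h / 2) b -v b) <= e ->
  vnorm (strang T S h p -v p -v h *v (a +v b)) <= 4 * C ^ 2 * e * h.
Proof.
  intros HT HS HC Hh He HTC HSC Hra Hrb HTa HSa HTb.
  pose proof (sg_lin HT (h / 2) ltac:(lra)) as LT. pose proof (sg_lin HS h ltac:(lra)) as LS.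
  set (ra := T (h / 2) p -v p -v (h / 2) *v a) in *.
  set (rb := S h p -v p -v h *v b) in *.
  assert (Hid : strang T S h p -v p -v h *v (a +v b) =
    T (h / 2) (S h ra) +v T (h / 2) rb +v ra +v (h / 2) *v T (h / 2) (S h a -v a)
    +v (h / 2) *v (T (h / 2) a -v a) +v h *v (T (h / 2) b -v b)).
  { unfold strang, ra, rb. repeat rewrite ?(lin_sub LS), ?(lin_scal LS), ?(lin_sub LT), ?(lin_scal LT).
    vring. }
  assert (HTn : forall z B, vnorm z <= B -> vnorm (T (h / 2) z) <= C * B).
  { intros z B Hz. eapply Rle_trans; [apply HTC; lra|]. apply Rmult_le_compat_l; lra. }
  assert (Hsc : forall r (z : Y) B, 0 <= r -> vnorm z <= B -> vnorm (r *v z) <= r * B).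
  { intros r z B Hr Hz. rewrite vnorm_scal_pos by easy. now apply Rmult_le_compat_l. }
  assert (HSra : vnorm (S h ra) <= C * (e * (h / 2))).
  { eapply Rle_trans; [apply HSC; lra|]. apply Rmult_le_compat_l; lra. }
  clearbody ra rb. rewrite Hid. eapply Rle_trans.
  - repeat apply vnorm_add_le; [apply HTn, HSra|apply HTn, Hrb|apply Hra
      |apply Hsc; [lra|apply HTn, HSa]|apply Hsc; [lra|apply HTa]|apply Hsc; [lra|apply HTb]].
  - assert (Heh : 0 <= e * h) by (apply Rmult_le_pos; lra).
    assert (HCC : C <= C * C) by nra.
    replace (_ + _) with ((C * C / 2 + C + C / 2 + 2) * (e * h)) by field.
    replace (4 * C ^ 2 * e * h) with (4 * (C * C) * (e * h)) by ring.
    apply Rmult_le_compat_r; lra.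
Qed.

Theorem mainTheorem6
  (X : Banach) (A B AB : Op X) (T S U : R -> X -> X)
  (* standing setting *)
  (HAlin : is_linear_op A) (HAcl : closed_op A) (HAdd : densely_defined A)
  (HBlin : is_linear_op B) (HBcl : closed_op B) (HBdd : densely_defined B)
  (HAgen : generates A T) (HBgen : generates B S)
  (HABcl : is_closure_of AB (op_sum A B))
  (HABdom : forall x, dom A x -> dom B x -> dom AB x)
  (HABgen : generates AB U)
  (* approximation setting *)
  (Xm : nat -> Banach)
  (P : forall m, X -> Xm m) (J : forall m, Xm m -> X)
  (HP : forall m, is_bounded_linear (P m)) (HJ : forall m, is_bounded_linear (J m))
  (HPJ : forall m (y : Xm m), P m (J m y) = y)
  (HJP : forall x, seq_lim (fun m => J m (P m x)) x)
  (MJ MP : R)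
  (HMJ : forall m (y : Xm m), vnorm (J m y) <= MJ * vnorm y)
  (HMP : forall m (x : X), vnorm (P m x) <= MP * vnorm x)
  (Am Bm : forall m, Op (Xm m))
  (Tm Sm : forall m, R -> Xm m -> Xm m)
  (HAmgen : forall m, generates (Am m) (Tm m))
  (HBmgen : forall m, generates (Bm m) (Sm m))
  (* stability *)
  (MT wT : R) (HMT : 1 <= MT)
  (HS1 : forall h, 0 < h ->
     (forall x, vnorm (T h x) <= MT * exp (wT * h) * vnorm x) /\
     (forall m (y : Xm m), vnorm (Tm m h y) <= MT * exp (wT * h) * vnorm y))
  (MS wS : R) (HMS : 1 <= MS)
  (HS2 : forall h, 0 < h ->
     (forall x, vnorm (S h x) <= MS * exp (wS * h) * vnorm x) /\
     (forall m (y : Xm m), vnorm (Sm m h y) <= MS * exp (wS * h) * vnorm y))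
  (M w : R) (HM : 1 <= M)
  (HSseq : forall t, 0 <= t -> forall (k n m : nat), (1 <= n)%nat -> (1 <= k)%nat ->
     forall y : Xm m,
       vnorm (Nat.iter k (fun z => Sm m (t / INR n) (Tm m (t / INR n) z)) y)
         <= M * exp (INR k * w * t / INR n) * vnorm y)
  (* consistency *)
  (HC1 : forall x, dom A x ->
     (forall m, dom (Am m) (P m x)) /\
     seq_lim (fun m => J m (app (Am m) (P m x))) (app A x))
  (HC2 : forall x, dom B x ->
     (forall m, dom (Bm m) (P m x)) /\
     seq_lim (fun m => J m (app (Bm m) (P m x))) (app B x)) :
  forall t, 0 < t -> forall x : X, forall eps, 0 < eps ->
    exists N : nat, forall n m : nat, (N <= n)%nat -> (N <= m)%nat ->
      vnorm (vsub
        (J m (Nat.iter n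
           (fun z => Tm m (t / (2 * INR n)) (Sm m (t / INR n) (Tm m (t / (2 * INR n)) z)))
           (P m x)))
        (U t x)) <= eps.

Proof.
  intros t Ht x eps Heps.
  assert (HPlin : forall m, is_linear (P m)) by (intros m; apply HP).
  (* The maxima with [1] make the bounds positive, as they occur in denominators. *)
  set (MP' := Rmax 1 MP). set (MJ' := Rmax 1 MJ).
  assert (HMP0 : 0 < MP') by (pose proof (Rmax_l 1 MP); unfold MP'; lra).
  assert (HMJ0 : 0 < MJ') by (pose proof (Rmax_l 1 MJ); unfold MJ'; lra).
  assert (HMP' : forall m x, vnorm (P m x) <= MP' * vnorm x).
  { intros m z. eapply Rle_trans; [apply HMP|].
    apply Rmult_le_compat_r; [apply vnorm_nonneg|apply Rmax_r]. }
  assert (HMJ' : forall m y, vnorm (J m y) <= MJ' * vnorm y).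
  { intros m z. eapply Rle_trans; [apply HMJ|].
    apply Rmult_le_compat_r; [apply vnorm_nonneg|apply Rmax_r]. }
  assert (HTsg : forall m, is_C0_semigroup (Tm m)) by (intros m; apply HAmgen).
  assert (HSsg : forall m, is_C0_semigroup (Sm m)) by (intros m; apply HBmgen).
  set (C := Rmax 1 (Rmax (MT * exp (Rabs wT)) (MS * exp (Rabs wS)))).
  assert (HC : 1 <= C) by apply Rmax_l.
  assert (HTC : forall m h y, 0 <= h <= 1 -> vnorm (Tm m h y) <= C * vnorm y).
  { intros m h y Hh. eapply Rle_trans.
    - apply (growth_bound_unit _ _ MT wT (HTsg m) HMT); [|easy].
      intros h' Hh' z. now apply HS1.
    - apply Rmult_le_compat_r; [apply vnorm_nonneg|].
      eapply Rle_trans; [apply Rmax_l|apply Rmax_r]. }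
  assert (HSC : forall m h y, 0 <= h <= 1 -> vnorm (Sm m h y) <= C * vnorm y).
  { intros m h y Hh. eapply Rle_trans.
    - apply (growth_bound_unit _ _ MS wS (HSsg m) HMS); [|easy].
      intros h' Hh' z. now apply HS2.
    - apply Rmult_le_compat_r; [apply vnorm_nonneg|].
      eapply Rle_trans; [apply Rmax_r|apply Rmax_r]. }
  assert (HF : forall m h, 0 < h -> is_linear (strang (Tm m) (Sm m) h)).
  { intros m h Hh. apply (lin_comp _ _ _ (Tm m (h / 2))); [apply sg_lin; [easy|lra]|].
    apply lin_comp; apply sg_lin; easy || lra. }
  assert (HM1 : 1 <= C ^ 3 * M).
  { assert (1 <= C ^ 3) by now apply pow_R1_Rle. nra. }
  assert (Hstab : forall m h k (y : Xm m), 0 < h <= 1 ->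
    vnorm (Nat.iter k (strang (Tm m) (Sm m) h) y)
      <= C ^ 3 * M * exp (INR k * (Rabs w * h)) * vnorm y).
  { intros m h k y Hh. apply strang_stable; try easy; try apply HTC; try apply HSC.
    intros j z. destruct j as [|j].
    - simpl INR. rewrite Rmult_0_l, exp_0. simpl Nat.iter. pose proof (vnorm_nonneg _ z). nra.
    (* Taking time [h] in a single step turns the bound for [t / n] into one for an arbitrary step
       size. *)
    - pose proof (HSseq h ltac:(lra) (Datatypes.S j) 1%nat m (le_n 1) ltac:(lia) z) as H.
      replace (h / INR 1) with h in H by (simpl; field).
      now replace (INR (Datatypes.S j) * w * h / INR 1)
        with (INR (Datatypes.S j) * (w * h)) in H by (simpl (INR 1); field). }
  (* The graph of [A + B]. By uniqueness of limits an orbit derivative of [U] is a value of [AB],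
     and the closure hypothesis approximates that pair from [D]. *)
  set (D := fun y c => dom A y /\ dom B y /\ c = app A y +v app B y).
  assert (Hcore : forall y c, orbit_deriv U y c -> forall e, 0 < e ->
    exists y' c', D y' c' /\ vnorm (y -v y') <= e /\ vnorm (c -v c') <= e).
  { intros y c Hyc e He. destruct HABgen as [_ Hgen]. destruct (Hgen y) as [Hdom Happ].
    assert (Hy : dom AB y) by (apply Hdom; now exists c).
    assert (Hc : app AB y = c) by (apply (rlim0_unique _ _ _ _ (Happ Hy) Hyc)).
    destruct (proj1 (HABcl y c) (conj Hy Hc)) as [u [Hu [Hlim Hlim']]].
    destruct (Hlim e He) as [N1 HN1]. destruct (Hlim' e He) as [N2 HN2].
    set (k := Nat.max N1 N2). exists (u k), (app (op_sum A B) (u k)).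
    specialize (HN1 k ltac:(lia)). specialize (HN2 k ltac:(lia)).
    rewrite (vnorm_sub_sym _ y), (vnorm_sub_sym _ c).
    destruct (Hu k) as [HuA HuB]. repeat split; try easy; lra. }
  assert (Hcons : forall y c, D y c -> forall e, 0 < e ->
    jointly (fun h m => vnorm (strang (Tm m) (Sm m) h (P m y) -v P m y -v h *v P m c) <= e * h)).
  { intros y c [HyA [HyB ->]] e He.
    assert (HC2p : 0 < 4 * C ^ 2) by (pose proof (pow_lt C 2 ltac:(lra)); lra).
    set (e' := e / (4 * C ^ 2)).
    assert (He' : 0 < e') by now apply Rdiv_lt_0_compat.
    pose proof (approx_continuous HAdd HPlin HPJ HMP0 HMP' HAmgen HC HTC HC1) as HcT.
    pose proof (approx_continuous HBdd HPlin HPJ HMP0 HMP' HBmgen HC HSC HC2) as HcS.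
    pose proof (approx_deriv HAdd HPlin HPJ HMP0 HMP' HAmgen HC HTC HC1 y e' HyA He') as HdT.
    pose proof (approx_deriv HBdd HPlin HPJ HMP0 HMP' HBmgen HC HSC HC2 y e' HyB He') as HdS.
    apply (jointly_mono _ _ (jointly_and _ _ (jointly_half _ HdT) (jointly_and _ _ HdS
      (jointly_and _ _ (HcT (app A y) e' He') (jointly_and _ _ (HcS (app A y) e' He')
      (jointly_and _ _ (HcT (app B y) e' He') (jointly_small 1 Rlt_0_1))))))).
    intros h m Hh [H1 [H2 [H3 [H4 [H5 Hh1]]]]]. rewrite (lin_add (HPlin m)).
    replace (e * h) with (4 * C ^ 2 * e' * h) by (unfold e'; field; lra).
    apply strang_expansion; try easy; try lra; try apply HTC; try apply HSC;
      [apply H3|apply H4|apply H5]; lra. }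
  assert (HJlim : jointly (fun _ m => vnorm (J m (P m (U t x)) -v U t x) <= eps / 2)).
  { apply (jointly_large (fun m => vnorm (J m (P m (U t x)) -v U t x) <= eps / 2)).
    destruct (HJP (U t x) (eps / 2) ltac:(lra)) as [N HN].
    exists N. intros m Hm. apply Rlt_le. now apply HN. }
  assert (He2 : 0 < eps / (2 * MJ')) by (apply Rdiv_lt_0_compat; lra).
  pose proof (chernoff_product_formula (proj1 HABgen) HPlin HMP0 HMP' HF HM1 (Rabs_pos w)
    Hstab Hcore Hcons x t _ Ht He2) as Hmain.
  destruct (jointly_step_size _ t Ht (jointly_and _ _ Hmain HJlim)) as [N HN].
  exists N. intros n m Hn Hm. destruct (HN n m Hn Hm) as [Hn0 [H1 H2]].
  apply lt_INR in Hn0. simpl in Hn0.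
  specialize (H1 n ltac:(field; lra)).
  replace (t / (2 * INR n)) with (t / INR n / 2) by (field; lra).
  change (Nat.iter n _ (P m x)) with (Nat.iter n (strang (Tm m) (Sm m) (t / INR n)) (P m x)).
  set (v := Nat.iter n (strang (Tm m) (Sm m) (t / INR n)) (P m x)) in *.
  eapply Rle_trans; [apply (vnorm_dist_triangle _ (J m (P m (U t x))))|].
  rewrite <- (lin_sub (proj1 (HJ m))).
  assert (H3 : vnorm (J m (v -v P m (U t x))) <= eps / 2).
  { eapply Rle_trans; [apply HMJ'|].
    replace (eps / 2) with (MJ' * (eps / (2 * MJ'))) by (field; lra).
    apply Rmult_le_compat_l; lra. }
  lra.
Qed.
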